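(* There is a randomized algorithm that, given a directed graph $G$ (with a set $V^\infty(G)$ of undeletable vertices), a set $T\subseteq V(G)$ and an integer $k$, runs in time $O^*(4^k)$ and produces a random set $Z\subseteq V(G)\setminus T$ such that the following holds. Let $W$ be a thin set with $|W|\le k$, and let $Y$ be a set of vertices such that for every $v\in Y$ there is an important $v-T$ separator $W'\subseteq W$. For every such pair $(W,Y)$, the probability that both $W\cap Z=\emptyset$ and $Y\subseteq Z$ hold is at least $2^{-O(k^2)}$.
   Context: $O^*(\cdot)$ hides polynomial factors in the input size. $G$ has a (possibly empty) set $V^\infty(G)$ of undeletable vertices. For disjoint nonempty $A,B\subseteq V(G)$, a set $W\subseteq V(G)\setminus(A\cup B\cup V^\infty(G))$ is an $A-B$ separator if $G\setminus W$ has no path from $A$ to $B$; it is minimal if no proper subset is an $A-B$ separator. We write $v-T$ for $\{v\}-T$. For a digraph $H$ and $A\subseteq V(H)$, $R^+_H(A)$ is the set of vertices reachable from $A$ in $H$. A minimal $A-B$ separator $W$ is an important $A-B$ separator if there is no $A-B$ separator $W'$ with $|W'|\le|W|$ and $R^+_{G\setminus W}(A)\subsetneq R^+_{G\setminus W'}(A)$. The reverse shadow of a set $W\subseteq V(G)\setminus V^\infty(G)$ (with respect to $T$) is the set of vertices $v$ such that $W$ is a $v-T$ separator. A set $W$ is thin if no $v\in W$ belongs to the reverse shadow of $W\setminus\{v\}$ with respect to $T$.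
   Formalization: The thin set W is required to be disjoint from T (and from the undeletable vertices, where shadows are defined); without disjointness from T the claim fails, e.g. for v→b→t with T={t}, W={v,b,t}, Y={v}. *)

(* Defs.v *)
From HB Require Import structures.
From mathcomp Require Import all_boot all_order all_algebra.
Set Implicit Arguments.
Unset Strict Implicit.
Unset Printing Implicit Defensive.

(** * Separators in digraphs with undeletable vertices *)

Section Separators.
Variables (V : finType) (arc : rel V) (Vinf : {set V}).
Implicit Types A B T W : {set V}.

(* The arcs of G \ W; the vertices of W stay in the carrier as isolated ones. *)
Definition arcD W : rel V :=
  [rel x y | [&& arc x y, x \notin W & y \notin W]].

(* [connect] is reflexive, so the sources lying in W are removed explicitly. *)
Definition reach W A : {set V} :=
  [set y | [exists x in A :\: W, connect (arcD W) x y]].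

Definition separator A B W : bool :=
  [&& A != set0, B != set0, [disjoint A & B],
      W \subset ~: (A :|: B :|: Vinf)
    & [forall a in A, forall b in B, ~~ connect (arcD W) a b]].

Definition minimal_separator A B W : bool :=
  separator A B W &&
  [forall W' : {set V}, (W' \proper W) ==> ~~ separator A B W'].

Definition important_separator A B W : bool :=
  minimal_separator A B W &&
  ~~ [exists W' : {set V},
        [&& separator A B W', #|W'| <= #|W| & reach W A \proper reach W' A]].

Definition reverse_shadow T W : {set V} := [set v | separator [set v] T W].

Definition thin T W : bool :=
  [forall v in W, v \notin reverse_shadow T (W :\ v)].

End Separators.

(** * Randomized algorithms and their running time

  The model of computation is a first-order, call-by-value functional language
  over binary trees (cons cells), with general recursion and a fair coin.
  The running time is the number of evaluation rules applied.  Every rule is a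
  constant number of pointer operations on a random access machine, and
  conversely a random access machine is simulated with a logarithmic overhead,
  so that time bounds of the form 4^k * poly(input size) are meaningful. *)

Inductive tree : Type := Leaf | Node of tree & tree.

Fixpoint tree_size (t : tree) : nat :=
  if t is Node a b then (tree_size a + tree_size b).+1 else 1.

(* Variables are de Bruijn indices. *)
Inductive expr : Type :=
| EVar of nat
| ELeaf
| ENode of expr & expr
| ECase of expr & expr & expr (* the Node branch binds both subtrees, left one at 0 *)
| ELet of expr & expr
| ECall of nat & expr         (* call of the i-th function of the program *)
| EFlip.                      (* consumes one random bit *)

(* A program is a list of (mutually recursive) bodies of unary functions, whose
   argument is variable 0; the entry point is function 0. *)
Definition program := seq expr.

Definition enc_bool (b : bool) : tree := if b then Node Leaf Leaf else Leaf.

(* [eval P env e w v w' t]: in the environment [env] and with the random bits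
   [w], [e] evaluates to [v] in time [t], leaving the random bits [w']. *)
Inductive eval (P : program) :
  seq tree -> expr -> seq bool -> tree -> seq bool -> nat -> Prop :=
| EvVar env i w v :
    onth env i = Some v -> eval P env (EVar i) w v w 1
| EvLeaf env w :
    eval P env ELeaf w Leaf w 1
| EvNode env e1 e2 w0 w1 w2 v1 v2 t1 t2 :
    eval P env e1 w0 v1 w1 t1 -> eval P env e2 w1 v2 w2 t2 ->
    eval P env (ENode e1 e2) w0 (Node v1 v2) w2 (t1 + t2).+1
| EvCaseLeaf env e e1 e2 w0 w1 w2 v t t1 :
    eval P env e w0 Leaf w1 t -> eval P env e1 w1 v w2 t1 ->
    eval P env (ECase e e1 e2) w0 v w2 (t + t1).+1
| EvCaseNode env e e1 e2 w0 w1 w2 a b v t t2 :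
    eval P env e w0 (Node a b) w1 t ->
    eval P [:: a, b & env] e2 w1 v w2 t2 ->
    eval P env (ECase e e1 e2) w0 v w2 (t + t2).+1
| EvLet env e1 e2 w0 w1 w2 v1 v t1 t2 :
    eval P env e1 w0 v1 w1 t1 -> eval P (v1 :: env) e2 w1 v w2 t2 ->
    eval P env (ELet e1 e2) w0 v w2 (t1 + t2).+1
| EvCall env f body e w0 w1 w2 a v t1 t2 :
    eval P env e w0 a w1 t1 -> onth P f = Some body ->
    eval P [:: a] body w1 v w2 t2 ->
    eval P env (ECall f e) w0 v w2 (t1 + t2).+1
| EvFlip env b w :
    eval P env EFlip (b :: w) (enc_bool b) w 1.

Definition runs (P : program) (input : tree) (w : seq bool)
    (output : tree) (t : nat) : Prop :=
  exists w', eval P [:: input] (ECall 0 (EVar 0)) w output w' t.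

Lemma eval_det (P : program) env e w v w' t v2 w2 t2 :
  eval P env e w v w' t -> eval P env e w v2 w2 t2 ->
  [/\ v = v2, w' = w2 & t = t2].
Proof.
move=> H; elim: H v2 w2 t2 => {env e w v w' t}.
- by move=> env i w v Hv v2 w2 t2 H; inversion H; subst; split => //; congruence.
- by move=> env w v2 w2 t2 H; inversion H.
- move=> env e1 e2 w0 w1 w2 u1 u2 t1 t2 _ IH1 _ IH2 v' w' t' H.
  inversion H; subst.
  by case: (IH1 _ _ _ ltac:(eassumption)) => ???; subst;
     case: (IH2 _ _ _ ltac:(eassumption)) => ???; subst.
- move=> env e e1 e2 w0 w1 w2 u s1 s2 _ IH1 _ IH2 v' w' t' H.
  inversion H; subst;
    case: (IH1 _ _ _ ltac:(eassumption)) => // _ ??; subst.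
  by case: (IH2 _ _ _ ltac:(eassumption)) => ???; subst.
- move=> env e e1 e2 w0 w1 w2 a b u s1 s2 _ IH1 _ IH2 v' w' t' H.
  inversion H; subst;
    case: (IH1 _ _ _ ltac:(eassumption)) => // - [??] ??; subst.
  by case: (IH2 _ _ _ ltac:(eassumption)) => ???; subst.
- move=> env e1 e2 w0 w1 w2 u1 u t1 t2 _ IH1 _ IH2 v' w' t' H.
  inversion H; subst.
  by case: (IH1 _ _ _ ltac:(eassumption)) => ???; subst;
     case: (IH2 _ _ _ ltac:(eassumption)) => ???; subst.
- move=> env f body e w0 w1 w2 a u t1 t2 _ IH1 Hf _ IH2 v' w' t' H.
  inversion H; subst.
  case: (IH1 _ _ _ ltac:(eassumption)) => ???; subst.
  have ? : body = body0 by congruence.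
  by subst; case: (IH2 _ _ _ ltac:(eassumption)) => ???; subst.
- by move=> env b w v2 w2 t2 H; inversion H; subst.
Qed.

(** * Encoding of inputs and outputs *)

Definition enc_seq (s : seq tree) : tree := foldr Node Leaf s.

Definition enc_bits (s : seq bool) : tree := enc_seq [seq enc_bool b | b <- s].

(* Binary digits, least significant first. *)
Definition bits (k : nat) : seq bool :=
  mkseq (fun i => odd (k %/ 2 ^ i)) (trunc_log 2 k).+1.

Section Encoding.
Variable V : finType.

Definition enc_set (A : {set V}) : tree := enc_bits [seq v \in A | v <- enum V].

(* Adjacency matrix, with rows and columns in the order of [enum V]. *)
Definition enc_arc (arc : rel V) : tree :=
  enc_seq [seq enc_bits [seq arc u v | v <- enum V] | u <- enum V].

Definition enc_input (arc : rel V) (Vinf T : {set V}) (k : nat) : tree :=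
  enc_seq [:: enc_arc arc; enc_set Vinf; enc_set T; enc_bits (bits k)].

End Encoding.

(* Probability of an event under B independent fair coin tosses. *)
Definition coin_prob (B : nat) (E : {set B.-tuple bool}) : rat :=
  (#|E|%:R / (2 ^ B)%:R)%R.

(* Main.v *)
Require Import Defs.
From HB Require Import structures.
From mathcomp Require Import all_boot all_order all_algebra zify.
Set Implicit Arguments.
Unset Strict Implicit.
Unset Printing Implicit Defensive.

(** Draw a random set [U] that contains every vertex independently with
    probability [p = 2^-(4k+4)], and let [Z] be the set of the vertices [v] such
    that some member of a family [F v] of [v]-[T] separators is contained in [U].
    The family [F v] has at most [4^k] members and contains all important [v]-[T]
    separators of size at most [k]: it is found by branching on a vertex of the
    min-cut closest to [T].  If [W] is contained in [U] then [Y] is contained in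
    [Z].  As [W] is thin, every member of [F x] with [x] in [W] has a vertex
    outside [W], so that, conditionally on [W] being contained in [U], the set [Z]
    meets [W] with probability at most [k 4^k p < 1/2].  Hence the probability of
    success is at least [p^k / 2].

    The branching works on a residual network.  Reversing the arcs of a path from
    the source to the target lowers the capacity of every cut by one, so all cuts
    can be compared without mentioning flows.  A separator [S] is reached by
    exactly [|S|] augmentations and [|S|] deletions, hence with fuel [2k]. *)

(** * Residual networks *)

Section Residual.
Variables (N : finType) (inf : rel N).
Implicit Types (m : N -> N -> nat) (X Q Tp : {set N}) (p : N -> seq N).

Definition avail m : rel N := [rel x y | inf x y || (0 < m x y)].

Definition incm m a b : N -> N -> nat :=
  fun x y => if (x == a) && (y == b) then (m x y).+1 else m x y.

Definition decm m a b : N -> N -> nat :=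
  fun x y => if (x == a) && (y == b) then (m x y).-1 else m x y.

(* Pushing one unit of flow along a path reverses its arcs. *)
Fixpoint augment m (q : seq N) : N -> N -> nat :=
  if q is x :: q' then
    if q' is y :: _ then augment (incm (decm m x y) y x) q' else m
  else m.

Lemma augment_out m q a b : a \notin q -> augment m q a b = m a b.
Proof.
elim: q m => [|x [|y q] IH] m // aq.
have -> : augment m (x :: y :: q) = augment (incm (decm m x y) y x) (y :: q) by [].
rewrite IH; last by move: aq; rewrite inE negb_or => /andP[].
move: aq; rewrite !inE !negb_or => /and3P[ax ay _].
by rewrite /incm /decm (negbTE ax) (negbTE ay).
Qed.

(** * Cuts and their behaviour under augmentation *)

Definition cut m X := \sum_(x in X) \sum_(y in ~: X) m x y.

(** [cut] sums [m] alone, so it is the true capacity only of a set that no infinite arc leaves. *)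
Definition good X := [forall x in X, forall y, inf x y ==> (y \in X)].

Definition closed_in m X := forall x y, x \in X -> avail m x y -> y \in X.

Lemma closed_good m X : closed_in m X -> good X.
Proof.
move=> cX; apply/forall_inP => x xX; apply/forallP => y; apply/implyP => ixy.
by apply: cX xX _; rewrite /avail /= ixy.
Qed.

Lemma closed_cut m X : closed_in m X -> cut m X = 0.
Proof.
move=> cX; rewrite /cut big1 // => x xX; rewrite big1 // => y.
rewrite inE; apply: contraNeq; rewrite -lt0n => m0.
by apply: cX xX _; rewrite /avail /= m0 orbT.
Qed.

Lemma goodP X x y : good X -> x \in X -> inf x y -> y \in X.
Proof. by move=> /forall_inP gX /gX/forallP/(_ y)/implyP; apply. Qed.

Lemma goodU X Q : good X -> good Q -> good (X :|: Q).
Proof.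
move=> gX gQ; apply/forall_inP => x; rewrite inE => xXQ.
apply/forallP => y; apply/implyP => ixy; rewrite inE.
by case/orP: xXQ => xX; rewrite (goodP _ xX ixy) ?orbT.
Qed.

Lemma cutE m X : cut m X = \sum_(x : N) \sum_(y : N) m x y * ((x \in X) && (y \notin X)).
Proof.
rewrite /cut big_mkcond; apply: eq_bigr => x _; case: (x \in X) => /=.
  rewrite big_mkcond; apply: eq_bigr => y _; rewrite inE.
  by case: (y \in X); rewrite ?muln0 ?muln1.
by rewrite big1 // => y _; rewrite muln0.
Qed.

(** Submodularity with the cut of the intersection dropped. It is applied with one of the two sets
    closed, hence of cut zero. *)
Lemma cut_submodular m X Q : cut m (X :|: Q) <= cut m X + cut m Q.
Proof.
rewrite !cutE -big_split /=; apply: leq_sum => x _.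
rewrite -big_split /=; apply: leq_sum => y _.
rewrite -mulnDr leq_mul2l !inE; apply/orP; right.
by case: (x \in X); case: (y \in X); case: (x \in Q); case: (y \in Q).
Qed.

Lemma sum_point (F G : N -> N -> nat) a b (d : nat) :
    (forall x y, (x == a) && (y == b) = false -> F x y = G x y) ->
    F a b = G a b + d ->
  \sum_x \sum_y F x y = \sum_x \sum_y G x y + d.
Proof.
move=> FG Fab; rewrite (bigD1 a) //= (bigD1 b) //= Fab.
rewrite [in RHS](bigD1 a) //= [in RHS](bigD1 b) //=.
under eq_bigr => y yb do rewrite FG ?(negbTE yb) ?andbF //.
under [X in _ + _ + X = _]eq_bigr => x xa.
  under eq_bigr => y _ do rewrite FG ?(negbTE xa) //.
  over.
lia.
Qed.

Lemma cut_incm m a b X :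
  cut (incm m a b) X = cut m X + ((a \in X) && (b \notin X)).
Proof.
rewrite !cutE; apply: (@sum_point _ _ a b) => [x y|]; rewrite /incm.
  by move=> ->.
by rewrite !eqxx /=; case: (_ && _); rewrite ?muln0 ?muln1 ?addn1.
Qed.

Lemma cut_decm m a b X :
    ((a \in X) && (b \notin X) -> 0 < m a b) ->
  cut (decm m a b) X + ((a \in X) && (b \notin X)) = cut m X.
Proof.
move=> ab0; rewrite !cutE; symmetry; apply: (@sum_point _ _ a b) => [x y|].
  by rewrite /decm => ->.
rewrite /decm !eqxx /=; case: (_ && _) ab0 => [/(_ isT)|_]; rewrite ?muln0 //.
by lia.
Qed.

(** A path that ends outside [X] leaves [X] once more than it enters it if it starts in [X], and
    equally often otherwise. Every exit costs one unit and every entry gives one back. *)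
Lemma cut_augment m x q X :
    good X -> path (avail m) x q -> uniq (x :: q) -> last x q \notin X ->
  cut (augment m (x :: q)) X + (x \in X) = cut m X.
Proof.
move=> gX; elim: q m x => [|y q IH] m x.
  by move=> _ _ /= /negbTE ->; rewrite addn0.
rewrite [path _ _ _]/= => /andP[axy pq] uxq lX.
have /= /andP[xyq /andP[yq uq]] := uxq.
move: xyq; rewrite inE negb_or => /andP[xy xq].
set m' := incm (decm m x y) y x.
rewrite -/(augment m' (y :: q)).
(* Only arcs at [x] have changed, and a simple path does not return to [x]. *)
have pq' : path (avail m') y q.
  apply: (sub_in_path (P := [pred z | z != x])) pq => /=; last first.
    by rewrite eq_sym xy; apply/allP => z zq; apply: contraNneq xq => <-.
  move=> a b; rewrite !inE => ax bx; rewrite /avail /= /m' /incm /decm.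
  by rewrite (negbTE ax) (negbTE bx) andbF.
have := IH m' y pq' _ lX; rewrite /= yq uq => /(_ isT) IHy.
(* An arc leaving a good set is not infinite, so it is available through a positive capacity and the
   truncated predecessor is exact. *)
have dec : (x \in X) && (y \notin X) -> 0 < m x y.
  case/andP=> xX yX; move: axy; rewrite /avail /= => /orP[ixy|//].
  by rewrite (goodP gX xX ixy) in yX.
move: (cut_decm dec) (cut_incm (decm m x y) y x X) IHy; rewrite -/m'.
move: (cut _ _) (cut _ _) (cut _ _) (cut _ _) => a b c d.
by case: (x \in X); case: (y \in X) => /=; clear; lia.
Qed.

(** * Search for augmenting paths in rounds *)

Fixpoint scan m p x (l : seq N) : seq N :=
  if l is y :: l' then
    if avail m x y && (p y != [::]) then x :: p y else scan m p x l'
  else [::].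

Definition round (ns : seq N) m p : N -> seq N :=
  fun x => if p x is [::] then scan m p x ns else p x.

Definition start_paths Tp : N -> seq N := fun x => if x \in Tp then [:: x] else [::].

(* [paths ns m Tp x] is a path from [x] to [Tp], or [::] if there is none. *)
Definition paths ns m Tp := iter (size ns) (round ns m) (start_paths Tp).

Lemma scanP m p x l :
  if has (fun y => avail m x y && (p y != [::])) l
  then exists2 y, avail m x y && (p y != [::]) & scan m p x l = x :: p y
  else scan m p x l = [::].
Proof.
elim: l => // y l IH; rewrite [scan _ _ _ _]/= [has _ _]/=.
by case: (boolP (avail m x y && _)) => //= yP; exists y.
Qed.

(** Since all nodes of a recorded path have an entry, prepending a node without one keeps the path
    simple. By the last clause a target is recognized by its path having a single node. *)
Definition path_table m Tp p := forall x, p x != [::] ->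
  exists q, [/\ p x = x :: q, path (avail m) x q && uniq (x :: q), last x q \in Tp,
               {in x :: q, forall y, p y != [::]} & (q == [::]) = (x \in Tp)].

Lemma start_path_table m Tp : path_table m Tp (start_paths Tp).
Proof.
move=> x; rewrite /start_paths; case: ifP => // xT _; exists [::]; split=> //.
by move=> y; rewrite inE => /eqP->; rewrite xT.
Qed.

Lemma iter_round_target ns m Tp i x :
  x \in Tp -> iter i (round ns m) (start_paths Tp) x = [:: x].
Proof. by move=> xT; elim: i => [|i] /=; rewrite /start_paths /round ?xT // => ->. Qed.

Lemma round_neq0 ns m p x : p x != [::] -> round ns m p x = p x.
Proof. by rewrite /round; case: (p x). Qed.

Lemma round_path_table ns m Tp p :
    (forall x, x \in Tp -> p x != [::]) ->
  path_table m Tp p -> path_table m Tp (round ns m p).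
Proof.
move=> pT tp x; have [px|px _] := eqVneq (p x) [::]; last first.
  have [q [pxE pq lq aq qT]] := tp x px; exists q; split=> //.
    by rewrite round_neq0.
  by move=> y /aq py; rewrite round_neq0.
have := scanP m p x ns; have <- : round ns m p x = scan m p x ns.
  by rewrite /round px.
case: ifP => [_ [y /andP[axy py] pxE] _|_ -> //].
have [q [pyE /andP[pq uq] lq aq qT]] := tp y py.
exists (y :: q); rewrite -pyE; split=> //.
- rewrite pyE cons_uniq uq andbT [path _ _ _]/= axy pq /=.
  by apply/negP => /aq; rewrite px.
- by rewrite pyE.
- move=> z; rewrite pyE inE => /orP[/eqP->|/aq pz]; last by rewrite round_neq0.
  by rewrite pxE.
- by rewrite (negbTE py); apply/esym/negbTE/negP => /pT; rewrite px.
Qed.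

Lemma pathsP ns m Tp : path_table m Tp (paths ns m Tp).
Proof.
rewrite /paths; elim: (size ns) => [|i IH]; first exact: start_path_table.
by apply: round_path_table IH => x xT; rewrite iter_round_target.
Qed.

Lemma paths_target ns m Tp x : x \in Tp -> paths ns m Tp x = [:: x].
Proof. exact: iter_round_target. Qed.

Definition no_path ns m Tp := [set x | paths ns m Tp x == [::]].

Lemma no_path_target ns m Tp x : x \in no_path ns m Tp -> x \notin Tp.
Proof.
by rewrite inE; apply: contraTN => /(paths_target ns m) ->.
Qed.

Definition stable m p := forall x y, p x = [::] -> avail m x y -> p y = [::].

Lemma round_stable ns m p : stable m p -> round ns m p =1 p.
Proof.
move=> sp x; rewrite /round; case px: (p x) => [|//].
have := scanP m p x ns; case: ifP => // _ [y /andP[axy]].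
by rewrite (sp _ _ px axy).
Qed.

Lemma eq_stable m p p' : p =1 p' -> stable m p -> stable m p'.
Proof. by move=> pp sp x y; rewrite -!pp; apply: sp. Qed.

(* As long as the table is not stable, every round serves a new node. *)
Lemma iter_round_stable ns m p i : (forall x, x \in ns) ->
  let pi := iter i (round ns m) p in
  stable m pi \/ i <= #|[set x | pi x != [::]]|.
Proof.
move=> nsT /=; elim: i => [|i IH]; first by right.
set pi := iter i _ _ in IH *; rewrite iterS -/pi.
case: IH => [st|lti].
  by left; apply: eq_stable (st) => x; rewrite round_stable.
have [/forallP st|] := boolP [forall x, forall y,
    (pi x == [::]) && avail m x y ==> (pi y == [::])].
  left; have st' : stable m pi.
    move=> x y px axy; apply/eqP; have /forallP/(_ y)/implyP := st x.
    by apply; rewrite px eqxx.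
  by apply: eq_stable (st') => x; rewrite round_stable.
rewrite negb_forall => /existsP[x]; rewrite negb_forall => /existsP[y].
rewrite negb_imply => /andP[/andP[/eqP px axy] py]; right.
apply: leq_ltn_trans lti _; apply: proper_card; apply/properP; split.
  by apply/subsetP => z; rewrite !inE => pz; rewrite round_neq0.
exists x; rewrite !inE ?px ?eqxx //; rewrite /round px.
have := scanP m pi x ns; case: ifP => [_ [z _ -> //]|/hasPn/(_ y (nsT y))].
by rewrite axy py.
Qed.

Lemma no_path_closed ns m Tp : (forall x, x \in ns) -> closed_in m (no_path ns m Tp).
Proof.
move=> nsT x y; rewrite !inE => /eqP px axy; apply/eqP.
have [st|lt] := @iter_round_stable ns m (start_paths Tp) (size ns) nsT.
  exact: st px axy.
(* If the table is still unstable, then at least [size ns] nodes are served. As [ns] lists all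
   nodes, this would include [x]. *)
have := px; suff /setP/(_ x) : [set z | paths ns m Tp z != [::]] = setT.
  by rewrite !inE => /eqP.
apply/eqP; rewrite eqEcard subsetT cardsT; apply: leq_trans lt.
rewrite cardE; apply: uniq_leq_size; first exact: enum_uniq.
by move=> z _; apply: nsT.
Qed.

(** Together with [no_path_closed] and [no_path_target], this makes [no_path] the largest closed set
    avoiding [Tp]: the source side of the minimum cut closest to the target, once the flow is
    maximal. *)
Lemma closed_sub_no_path ns m Tp X :
  closed_in m X -> [disjoint X & Tp] -> X \subset no_path ns m Tp.
Proof.
move=> cX dX; apply/subsetP => x xX; rewrite inE; apply/negPn/negP => px.
have [q [_ /andP[pq _] lq _ _]] := pathsP px.
suff lX : last x q \in X by have := disjointFr dX lX; rewrite lq.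
elim: q x xX pq {px lq} => //= y q IH x xX /andP[axy pq].
by apply: IH pq; apply: cX axy.
Qed.

(** All nodes of the pushed path can reach [Tp], so the path avoids [X] and no arc leaving [X] is
    modified. *)
Lemma augment_closed ns m Tp x X :
    closed_in m X -> [disjoint X & Tp] ->
  closed_in (augment m (paths ns m Tp x)) X.
Proof.
move=> cX dX y z yX; have [->|px] := eqVneq (paths ns m Tp x) [::]; first exact: cX.
have [q [-> _ _ aq _]] := pathsP px.
rewrite -[avail _ _ _]/(inf y z || (0 < augment m (x :: q) y z)) augment_out.
  exact: cX.
apply/negP => /aq; have /subsetP/(_ y yX) := closed_sub_no_path ns cX dX.
by rewrite inE => ->.
Qed.

Lemma cut_augment_paths ns m Tp x X :
    good X -> x \in X -> [disjoint X & Tp] -> paths ns m Tp x != [::] ->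
  (cut (augment m (paths ns m Tp x)) X).+1 = cut m X.
Proof.
move=> gX xX dX /pathsP[q [-> /andP[pq uq] lq _ _]].
rewrite -(cut_augment gX pq uq) ?xX ?addn1 //.
by apply: contraTN lq => /(disjointFr dX) ->.
Qed.

End Residual.

(** * Important separators as leaves of a branching on residual networks *)

Section Branching.
Variables (V : finType) (arc : rel V) (Vinf T : {set V}).
Implicit Types (Q X Tp : {set V * bool}) (S D : {set V}) (u v : V).

Local Notation N := (V * bool)%type.

(* The node [(v, false)] is the entrance of [v] and [(v, true)] its exit. *)
Definition net_inf : rel N := fun x y =>
  if x.2 then ~~ y.2 && arc x.1 y.1 else [&& y.2, x.1 == y.1 & x.1 \in Vinf].

Definition net_cap (x y : N) : nat := [&& ~~ x.2, y.2 & x.1 == y.1].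

Definition net_target : {set N} := [set x | x.1 \in T].

Definition nodes_of (l : seq V) : seq N :=
  flatten [seq [:: (v, false); (v, true)] | v <- l].

Definition nodes := nodes_of (enum V).

Lemma mem_nodes_of l x : (x \in nodes_of l) = (x.1 \in l).
Proof.
case: x => v b; elim: l => //= u l IH.
by rewrite !inE IH !xpair_eqE; case: (v == u); case: (b).
Qed.

Lemma mem_nodes x : x \in nodes.
Proof. by rewrite mem_nodes_of mem_enum. Qed.

(** An exit with a one-node path is a target. The size test thereby skips the vertices already
    decided to be in the separator, whose exits have been made targets. *)
Definition pick_crossing (p : N -> seq N) : option V :=
  ohead [seq u <- enum V | (p (u, false) == [::]) && (1 < size (p (u, true)))].

Lemma pick_crossing_size p u : pick_crossing p = Some u -> 1 < size (p (u, true)).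
Proof.
rewrite /pick_crossing; case E: [seq _ <- _ | _] => [//|w l] [<-].
have : w \in w :: l by rewrite inE eqxx.
by rewrite -E mem_filter => /andP[/andP[]].
Qed.

(** [s] is the node that was last put on the source side. Making the exit of [u] a target puts [u]
    into the separator; pushing flow from that exit puts it on the source side instead. A branch
    that runs out of fuel is dropped. *)
Fixpoint leaves f (m : N -> N -> nat) (s : N) Tp : seq {set V} :=
  let p := paths net_inf nodes m Tp in
  if p s != [::] then
    if f is f'.+1 then leaves f' (augment m (p s)) s Tp else [::]
  else if pick_crossing p is Some u then
    if f is f'.+1 then
      [seq u |: L | L <- leaves f' m s ((u, true) |: Tp)]
        ++ leaves f' (augment m (p (u, true))) (u, true) Tp
    else [::]
  else [:: set0].

Lemma size_leaves f m s Tp : size (leaves f m s Tp) <= 2 ^ f.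
Proof.
elim: f m s Tp => [|f IH] m s Tp /=.
  by case: ifP => // _; case: pick_crossing.
case: ifP => _; first by rewrite (leq_trans (IH _ _ _)) // leq_exp2l.
case: pick_crossing => [u|]; last by rewrite expn_gt0.
by rewrite size_cat size_map expnS mul2n -addnn leq_add.
Qed.

Definition crossing Q : {set V} := [set u | ((u, false) \in Q) && ((u, true) \notin Q)].

Lemma cut_net_cap Q : cut net_cap Q = #|crossing Q|.
Proof.
rewrite cutE -sum1_card (eq_bigr (fun x : N => \sum_y net_cap (x.1, x.2) y *
    (((x.1, x.2) \in Q) && (y \notin Q)))); last by case.
rewrite -(pair_bigA _ (fun v b => \sum_y net_cap (v, b) y *
    (((v, b) \in Q) && (y \notin Q)))) [RHS]big_mkcond.
apply: eq_bigr => v _; rewrite big_bool /= [X in X + _]big1 ?add0n; last by [].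
rewrite (bigD1 (v, true)) //= big1 => [|[u b] /=]; last first.
  rewrite xpair_eqE /net_cap /= eq_sym; case: b; rewrite ?andbF // andbT.
  by case: (v == u).
by rewrite /net_cap /= eqxx mul1n addn0 inE; case: (_ && _).
Qed.

(** An arc from an exit in [Q] leads to an entrance in [Q]. If the exit behind it were missing from
    [Q], the vertex would be crossing and so lie in [D]. *)
Lemma crossing_connect D Q v y :
    good net_inf Q -> (v, true) \in Q -> crossing Q \subset D ->
  connect (arcD arc D) v y -> (y, true) \in Q.
Proof.
move=> gQ vQ sQ /connectP[q pq ->]; elim: q v vQ pq => //= y' q IH v vQ.
case/andP=> /and3P[avy vD yD] pq; apply: IH pq.
have yQ : (y', false) \in Q by apply: (goodP gQ vQ).
by apply: contraNT yD => yQ'; apply: (subsetP sQ); rewrite inE yQ.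
Qed.

(** The exit of [v] is in [Q], the nodes of [T] are not, and an undeletable vertex carries an
    infinite arc from its entrance to its exit. *)
Lemma crossing_deletable Q v :
    good net_inf Q -> (v, true) \in Q -> [disjoint Q & net_target] ->
  crossing Q \subset ~: ([set v] :|: T :|: Vinf).
Proof.
move=> gQ vQ dQ; apply/subsetP => u; rewrite !inE => /andP[uQ uQ'].
rewrite !negb_or -andbA; apply/and3P; split.
- by apply: contraNneq uQ' => ->.
- by have := disjointFr dQ uQ; rewrite inE => ->.
- by apply: contraNN uQ' => uI; apply: (goodP gQ uQ); rewrite /net_inf /= eqxx.
Qed.

Lemma crossing_separator D Q v :
    T != set0 -> v \notin T -> good net_inf Q -> (v, true) \in Q ->
    [disjoint Q & net_target] -> crossing Q \subset D ->
    D \subset ~: ([set v] :|: T :|: Vinf) ->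
  separator arc Vinf [set v] T D.
Proof.
move=> T0 vT gQ vQ dQ sQ sD; apply/and5P; split=> //.
- by apply/set0Pn; exists v; rewrite inE.
- by rewrite disjoints1.
apply/forall_inP => a; rewrite inE => /eqP->; apply/forall_inP => b bT.
apply/negP => /(crossing_connect gQ vQ sQ) /(disjointFr dQ).
by rewrite inE bT.
Qed.

(** * The invariant of the branching *)

Variable v : V.

(* The residual capacities reached by the branching, with decided set [D]:
   everything from which flow was pushed lies in the closed set [X] or at [s]. *)
Definition branch_inv D m (s : N) Tp := exists X : {set N},
  [/\ closed_in net_inf m X, [disjoint X & Tp], (v, true) \in s |: X,
      Tp = net_target :|: [set x | x.2 & x.1 \in D]
    & D \subset ~: ([set v] :|: T :|: Vinf)].

Section Step.
Variables (D : {set V}) (m : N -> N -> nat) (s : N) (Tp : {set N}).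
Hypothesis inv : branch_inv D m s Tp.

Let p := paths net_inf nodes m Tp.
Let X := no_path net_inf nodes m Tp.

Lemma inv_augment : branch_inv D (augment m (p s)) s Tp.
Proof.
have [X' [cX dX vX TpE sD]] := inv; exists X'; split=> //.
exact: augment_closed.
Qed.

Lemma no_path_disjoint : [disjoint X & Tp].
Proof.
rewrite disjoint_subset; apply/subsetP => x xX.
exact: no_path_target xX.
Qed.

Lemma no_path_disjoint_target : [disjoint X & net_target].
Proof.
have [_ [_ _ _ TpE _]] := inv.
by apply: disjointWr no_path_disjoint; rewrite TpE subsetUl.
Qed.

Lemma no_path_good : good net_inf X.
Proof. by apply/closed_good/no_path_closed/mem_nodes. Qed.

Hypothesis ps : p s = [::].

Lemma source_no_path : (v, true) \in X.
Proof.
have [X' [cX dX vX _ _]] := inv; move: vX; rewrite in_setU1.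
case/orP => [/eqP->|]; first by rewrite inE -/p ps.
by apply/subsetP/closed_sub_no_path.
Qed.

(** The exit of a crossing vertex has a path, which consists of one node only if the exit is a
    target. The target exits are those of [T], excluded by [crossing_deletable], and those of
    [D]. *)
Lemma pick_crossingP :
  if pick_crossing p is Some u
  then [/\ u \in crossing X, u \notin D & u \notin [set v] :|: T :|: Vinf]
  else crossing X \subset D.
Proof.
have [_ [_ _ _ TpE _]] := inv.
have size_gt1 u : (1 < size (p (u, true))) = ((u, true) \notin X) && ((u, true) \notin Tp).
  rewrite !inE -/p; have [->//|pu] := eqVneq (p (u, true)) [::].
  by have [q []] := pathsP pu; rewrite -/p => -> _ _ _ /= <-; case: q.
have := crossing_deletable no_path_good source_no_path no_path_disjoint_target.
move=> /subsetP sX.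
rewrite /pick_crossing; case E: [seq _ <- _ | _] => [|u l] /=.
  apply/subsetP => u uX; have := sX u uX; move: uX.
  rewrite !inE !negb_or -!/p => /andP[pu pu'] /andP[/andP[_ uT] _].
  have : u \notin [::] by []; rewrite -E mem_filter mem_enum pu /= andbT size_gt1.
  by rewrite !inE -/p pu' TpE !inE /= negb_or (negbTE uT) /= negbK.
have : u \in u :: l by rewrite inE eqxx.
rewrite -E mem_filter => /andP[/andP[pu]]; rewrite size_gt1 => /andP[pu' uT] _.
have uX : u \in crossing X by rewrite inE pu' andbT inE.
split=> //; last by have := sX _ uX; rewrite inE.
by move: uT; rewrite TpE !inE /= negb_or => /andP[].
Qed.

Lemma inv_delete u : pick_crossing p = Some u ->
  branch_inv (u |: D) m s ((u, true) |: Tp).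
Proof.
move=> pu; have := pick_crossingP; rewrite pu => -[uX uD uV].
have [_ [_ _ _ TpE sD]] := inv; exists X; split.
- exact/no_path_closed/mem_nodes.
- rewrite disjoint_subset; apply/subsetP => x xX; rewrite inE in_setU1 negb_or.
  rewrite (no_path_target xX) andbT; apply: contraTneq xX => ->.
  by move: uX; rewrite inE => /andP[].
- by rewrite inE source_no_path orbT.
- apply/setP => -[y b]; rewrite TpE !inE xpair_eqE /=.
  by case: b; case: (y == u); rewrite ?orbT ?andbF ?orbF.
- by apply/subsetP => y; rewrite in_setU1 => /orP[/eqP->|/(subsetP sD)//]; rewrite inE.
Qed.

(** The witness becomes [no_path], which already contains the exit of [v]; the source is thus free
    to move elsewhere. *)
Lemma inv_push u : branch_inv D (augment m (p (u, true))) (u, true) Tp.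
Proof.
have [_ [_ _ _ TpE sD]] := inv; exists X; split=> //.
- by apply: augment_closed no_path_disjoint; apply/no_path_closed/mem_nodes.
- exact: no_path_disjoint.
- by rewrite inE source_no_path orbT.
Qed.

End Step.

Hypothesis (T0 : T != set0) (vT : v \notin T).

Lemma leaf_separator D m s Tp :
    let p := paths net_inf nodes m Tp in
    branch_inv D m s Tp -> p s = [::] -> pick_crossing p = None ->
  separator arc Vinf [set v] T D.
Proof.
move=> p inv ps pN; have := pick_crossingP inv ps; rewrite pN => sD.
apply: crossing_separator sD _ => //; first exact: no_path_good.
- exact: source_no_path inv ps.
- exact: no_path_disjoint_target inv.
- by case: inv => X [].
Qed.

Lemma leaves_separator f D m s Tp L :
    branch_inv D m s Tp -> L \in leaves f m s Tp ->
  separator arc Vinf [set v] T (D :|: L).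
Proof.
elim: f D m s Tp L => [|f IH] D m s Tp L inv /=.
  case: ifPn => //; rewrite negbK => /eqP ps; case E: pick_crossing => //.
  by rewrite inE => /eqP->; rewrite setU0; apply: leaf_separator inv ps E.
case: ifPn => [ps|]; first exact/IH/inv_augment.
rewrite negbK => /eqP ps; case E: pick_crossing => [u|]; last first.
  by rewrite inE => /eqP->; rewrite setU0; apply: leaf_separator inv ps E.
rewrite mem_cat => /orP[/mapP[L' L'l ->]|].
  by rewrite setUCA setUA; apply: IH L'l; exact (inv_delete inv ps E).
by apply: IH; apply: inv_push inv ps _.
Qed.

Lemma inv_start : branch_inv set0 net_cap (v, true) net_target.
Proof.
exists set0; split.
- by move=> x y; rewrite inE.
- by rewrite disjoint_subset; apply/subsetP => x; rewrite inE.
- by rewrite !inE eqxx.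
- by apply/setP => x; rewrite !inE andbF orbF.
- exact: sub0set.
Qed.

Lemma reach_notin D x y : x \in reach arc D [set y] -> x \notin D.
Proof.
rewrite inE => /exists_inP[a]; rewrite !inE => /andP[aD _] /connectP[q + ->].
elim: q a aD => //= b q IH a aD /andP[/and3P[_ _ bD]]; exact: IH.
Qed.

(** * Every important separator is a leaf *)

Section Important.
Variable S : {set V}.
Hypothesis impS : important_separator arc Vinf [set v] T S.

Let sepS : separator arc Vinf [set v] T S.
Proof. by case/andP: impS => /andP[]. Qed.

Let S_deletable : S \subset ~: ([set v] :|: T :|: Vinf).
Proof. by case/and5P: sepS. Qed.

(* [XS] is the largest cut of the network whose crossing vertices are those of [S]. *)
Let K : {set V} := [set x | (x \notin S) && [forall t in T, ~~ connect (arcD arc S) x t]].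

Let XS : {set N} := [set x | (x.1 \in K) || ~~ x.2 && (x.1 \in S)].

Let K_notin x : x \in K -> x \notin S.
Proof. by rewrite inE => /andP[]. Qed.

Let K_step x y : x \in K -> arc x y -> y \notin S -> y \in K.
Proof.
rewrite !inE => /andP[xS /forall_inP xT] axy yS; rewrite yS; apply/forall_inP => t tT.
apply: contraNN (xT _ tT) => cyt; apply: connect_trans cyt.
by apply: connect1; rewrite /arcD /= axy xS.
Qed.

Let vK : v \in K.
Proof.
rewrite inE; case/and5P: sepS => _ _ _ _ /forall_inP/(_ v); rewrite inE eqxx.
move=> /(_ isT) ->; rewrite andbT; apply/negP => /(subsetP S_deletable).
by rewrite !inE eqxx.
Qed.

Let in_XS x b : ((x, b) \in XS) = (x \in K) || ~~ b && (x \in S).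
Proof. by rewrite in_set. Qed.

Let vXS : (v, true) \in XS.
Proof. by rewrite in_XS vK. Qed.

Let good_XS : good net_inf XS.
Proof.
apply/forall_inP => -[x b] xX; apply/forallP => -[y c]; apply/implyP.
move: xX; rewrite !in_XS /net_inf /=; case: b => /= [|xX].
  rewrite orbF => xK /andP[cF axy]; rewrite cF /=.
  by have [//|/(K_step xK axy)] := boolP (y \in S); rewrite ?orbT // => ->.
case/and3P=> -> /eqP <- xI /=; case/orP: xX => [->//|xS].
by have := subsetP S_deletable _ xS; rewrite !inE xI !orbT.
Qed.

Let XS_target : [disjoint XS & net_target].
Proof.
rewrite disjoint_subset; apply/subsetP => -[x b].
rewrite in_XS !inE /= => xX; apply/negP => xT; case/orP: xX => [|/andP[_ xS]].
  by case/andP=> _ /forall_inP/(_ _ xT); rewrite connect0.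
by have := subsetP S_deletable _ xS; rewrite !inE xT orbT.
Qed.

Let crossing_XS : crossing XS = S.
Proof.
apply/setP => u; rewrite in_set !in_XS /= orbF.
by have [/K_notin/negbTE->|] := boolP (u \in K); rewrite ?andbT.
Qed.

Let XS_outS x : x \in S -> (x, true) \notin XS.
Proof. by rewrite -crossing_XS inE => /andP[]. Qed.

(** Otherwise [S :\ u] would still separate, against minimality: a path from [v] stays in the reach
    of [v], so it could never enter [u]. *)
Let source_arc u : u \in S -> exists2 x, x \in reach arc S [set v] & arc x u.
Proof.
move=> uS; apply/exists_inP; apply: contraT => /exists_inPn noarc.
case/andP: impS => /andP[_ /forallP/(_ (S :\ u))]; rewrite properD1 //= => /negP[].
case/and5P: sepS => v0 _ vTd _ /forall_inP/(_ v); rewrite inE eqxx.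
move=> /(_ isT)/forall_inP nc; apply/and5P; split=> //.
  exact: subset_trans (subD1set _ _) S_deletable.
apply/forall_inP => _ /set1P->; apply/forall_inP => t tT.
apply: contraNN (nc t tT) => /connectP[q pq ->] {tT}.
have main x : connect (arcD arc S) v x -> path (arcD arc (S :\ u)) x q ->
    connect (arcD arc S) v (last x q).
  elim: q x {pq} => //= y q IH x cvx /andP[/and3P[axy _ yS] pq]; apply: IH pq.
  have xR : x \in reach arc S [set v].
    by rewrite inE; apply/exists_inP; exists v => //; rewrite !inE eqxx K_notin.
  have yu : y != u by apply: contraTneq axy => ->; apply: noarc.
  apply: connect_trans cvx _; apply: connect1; rewrite /arcD /= axy.
  by move: yS; rewrite !inE yu /= => ->; rewrite (reach_notin xR).
exact: main.
Qed.

(* An [X] sticking out of [XS] would give a separator at most as large as [S]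
   that reaches strictly further. *)
Let sub_XS X : good net_inf X -> [disjoint X & net_target] ->
  #|crossing (X :|: XS)| <= #|S| -> X \subset XS.
Proof.
set Q := X :|: XS => gX dX leS.
have gQ : good net_inf Q by apply: goodU.
have vQ : (v, true) \in Q by rewrite inE vXS orbT.
have dQ : [disjoint Q & net_target].
  rewrite disjoint_subset; apply/subsetP => x; rewrite inE => /orP[] xX; rewrite inE.
    by rewrite (disjointFr dX xX).
  by rewrite (disjointFr XS_target xX).
have sepQ := crossing_separator T0 vT gQ vQ dQ (subxx _) (crossing_deletable gQ vQ dQ).
have KQ x : x \in K -> x \notin crossing Q.
  by move=> xK; rewrite in_set !in_setU !in_XS xK !orbT andbF.
have sR : reach arc S [set v] \subset reach arc (crossing Q) [set v].
  apply/subsetP => x; rewrite !inE => /exists_inP[a].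
  rewrite !inE => /andP[_ /eqP->] /connectP[q pq ->]; apply/exists_inP; exists v.
    by rewrite in_setD in_set1 eqxx KQ.
  elim: q (v) vK pq => //= y q IH z zK /andP[/and3P[azy _ yS] pq].
  have yK := K_step zK azy yS; apply: connect_trans (IH _ yK pq).
  by apply: connect1; rewrite /arcD /= azy !KQ.
(* Importance excludes a proper inclusion, since [crossing Q] is a separator of size at most that of
   [S]. *)
have eR : reach arc S [set v] = reach arc (crossing Q) [set v].
  apply/eqP; rewrite eqEproper sR /=; case/andP: impS => _; apply: contra => prR.
  by apply/existsP; exists (crossing Q); rewrite sepQ leS.
(* A vertex [u] of [S] is entered from the common reach. Were it not in [crossing Q], it would
   itself be reached, although it lies in [S]. *)
have SQ : S = crossing Q.
  apply/eqP; rewrite eqEcard leS andbT; apply/subsetP => u uS.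
  have [x xR axu] := source_arc uS; apply: contraT => uQ.
  suff /reach_notin : u \in reach arc S [set v] by rewrite uS.
  have xQ : x \notin crossing Q by apply: (@reach_notin _ _ v); rewrite -eR.
  move: xR; rewrite eR !inE => /exists_inP[a aQ cax]; apply/exists_inP; exists a => //.
  by apply: connect_trans cax _; apply: connect1; rewrite /arcD /= axu xQ.
(* This is where the maximality of [XS] enters: an exit in [Q] is outside [S] and cannot reach [T],
   which is the definition of [K]. *)
have outK x : (x, true) \in Q -> x \in K.
  move=> xQ; rewrite inE; apply/andP; split; first by rewrite SQ inE xQ andbF.
  apply/forall_inP => t tT; apply/negP => cxt.
  have tQ : (t, true) \in Q by apply: crossing_connect cxt => //; rewrite -SQ.
  by have := disjointFr dQ tQ; rewrite inE tT.
apply/subsetP => -[x b] xX; have xQ : (x, b) \in Q by rewrite inE xX.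
rewrite in_XS; case: b xX xQ => _ xQ; first by rewrite outK.
have [//|] := boolP (x \in S); rewrite ?orbT // SQ inE xQ negbK => /outK ->.
by [].
Qed.

(** The branch to follow is dictated by [S]: delete the crossing vertex if it is in [S], else push
    from its exit, which then lies in [XS]. [r] counts the units pushed so far, a loss shared by all
    the cuts above [XS]. A push lowers [cut m XS] and a deletion lowers the size of [S :\: D], so
    their sum bounds the fuel. *)
Lemma leaves_complete f D m s Tp r :
    branch_inv D m s Tp -> D \subset S -> s \in XS ->
    (forall Q, good net_inf Q -> XS \subset Q -> [disjoint Q & Tp] ->
       cut m Q + r = cut net_cap Q) ->
    cut m XS + #|S :\: D| <= f ->
  S :\: D \in leaves f m s Tp.
Proof.
(* The exits of vertices of [S] are outside [XS], so turning some of them into targets does not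
   touch [XS]. *)
have dXS D' Tp' m' s' : branch_inv D' m' s' Tp' -> D' \subset S -> [disjoint XS & Tp'].
  move=> [_ [_ _ _ -> _]] DS; rewrite disjoint_subset; apply/subsetP => -[x b] xX.
  have xT := disjointFr XS_target xX; rewrite inE in_setU xT inE /=.
  apply/negP => /andP[bT /(subsetP DS) xS].
  by move: xX; rewrite bT (negbTE (XS_outS xS)).
(* At a leaf [D'] already separates, so the minimality of [S] leaves nothing of [S] undecided. *)
have leaf D' m' s' Tp' : branch_inv D' m' s' Tp' -> D' \subset S ->
    let p' := paths net_inf nodes m' Tp' in p' s' = [::] -> pick_crossing p' = None ->
    S :\: D' = set0.
  move=> inv' DS p' ps pN; have sepD := leaf_separator inv' ps pN.
  apply/eqP; rewrite setD_eq0; apply: contraT => nSD.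
  case/andP: impS => /andP[_ /forallP/(_ D')/implyP/(_ _)/negP[]] //.
  by rewrite properE DS.
have crossXS D' m' s' Tp' r' u : branch_inv D' m' s' Tp' -> D' \subset S ->
    (forall Q, good net_inf Q -> XS \subset Q -> [disjoint Q & Tp'] ->
       cut m' Q + r' = cut net_cap Q) ->
    let p' := paths net_inf nodes m' Tp' in
    p' s' = [::] -> pick_crossing p' = Some u ->
    [/\ p' (u, true) != [::], u \notin D' & (u \in S) || ((u, true) \in XS)].
  move=> inv' DS cutr p' ps pu; have := pick_crossingP inv' ps; rewrite pu.
  set X := no_path _ _ _ _ => -[uX uD _]; move: uX; rewrite inE => /andP[uX uX'].
  split=> //; first by move: uX'; rewrite inE.
  have dX := no_path_disjoint m' Tp'; have gX := no_path_good m' Tp'.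
  suff /subsetP/(_ _ uX) : X \subset XS by rewrite !in_XS /= orbF orbC.
  apply: sub_XS => //; first exact: no_path_disjoint_target inv'.
  rewrite -{1}crossing_XS -!cut_net_cap.
  have dQ : [disjoint X :|: XS & Tp'].
    rewrite disjoint_subset; apply/subsetP => x; rewrite inE => /orP[] xX; rewrite inE.
      by rewrite (disjointFr dX xX).
    by rewrite (disjointFr (dXS _ _ _ _ inv' DS) xX).
  (* Both cuts have lost [r] units, so they may be compared in the residual network, where the
     closed set has cut zero. *)
  rewrite -(cutr _ (goodU gX good_XS) (subsetUr _ _) dQ).
  rewrite -(cutr _ good_XS (subxx _) (dXS _ _ _ _ inv' DS)) leq_add2r.
  apply: leq_trans (cut_submodular _ _ _) _.
  by rewrite (@closed_cut _ net_inf) //; apply/no_path_closed/mem_nodes.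
elim: f D m s Tp r => [|f IH] D m s Tp r inv DS sX cutr lef.
all: have dX := dXS _ _ _ _ inv DS.
all: have gX := good_XS.
all: have augX x : x \in XS -> paths net_inf nodes m Tp x != [::] -> 
  (cut (augment m (paths net_inf nodes m Tp x)) XS).+1 = cut m XS
  by move=> xX; apply: cut_augment_paths.
all: have cutr' x : x \in XS -> paths net_inf nodes m Tp x != [::] -> 
  forall Q, good net_inf Q -> XS \subset Q -> [disjoint Q & Tp] ->
   cut (augment m (paths net_inf nodes m Tp x)) Q + r.+1 = cut net_cap Q
  by move=> xX px Q gQ sQ dQ; rewrite -cutr // addnS -addSn;
     rewrite (cut_augment_paths gQ _ dQ px) // (subsetP sQ).
all: rewrite /=; case: ifPn => [ps|].
(* Without fuel the cut of [XS] is zero, so no unit can be pushed out of it. *)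
- by have := augX _ sX ps; move: lef; clear; lia.
- rewrite negbK => /eqP ps; case E: pick_crossing => [u|]; last first.
    by rewrite (leaf _ _ _ _ inv DS ps E) inE.
  have [pu uD /orP[uS|uX]] := crossXS _ _ _ _ _ _ inv DS cutr ps E.
    by move: lef; rewrite leqn0 addn_eq0 cards_eq0 => /andP[_ /eqP/setP/(_ u)];
       rewrite !inE uD uS.
  by have := augX _ uX pu; move: lef; clear; lia.
- apply: (IH _ _ _ _ r.+1) => //; first exact: inv_augment.
    exact: cutr'.
  by have := augX _ sX ps; move: lef; clear; lia.
rewrite negbK => /eqP ps; case E: pick_crossing => [u|]; last first.
  by rewrite (leaf _ _ _ _ inv DS ps E) inE.
have [pu uD /orP[uS|uX]] := crossXS _ _ _ _ _ _ inv DS cutr ps E; rewrite mem_cat.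
  apply/orP; left; apply/mapP; exists (S :\: (u |: D)); last first.
    apply/setP => x; rewrite !inE negb_or; have [->|] := eqVneq x u; last by [].
    by rewrite uS uD.
  apply: (IH _ _ _ _ r) => //; first exact (inv_delete inv ps E).
  - by rewrite subUset sub1set uS.
  - move=> Q gQ sQ dQ; apply: cutr => //; apply: disjointWr dQ; exact: subsetUr.
  - move: lef; rewrite (cardsD1 u (S :\: D)) in_setD uD uS setDDl setUC; clear; lia.
apply/orP; right; apply: (IH _ _ _ _ r.+1) => //; first exact: inv_push inv ps _.
  exact: cutr'.
by have := augX _ uX pu; move: lef; clear; lia.
Qed.

(** Initially the cut of [XS] and the undecided part both have size [#|S|], hence the fuel
    [#|S|.*2]. *)
Lemma important_leaf f : #|S|.*2 <= f ->
  S \in leaves f net_cap (v, true) net_target.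
Proof.
move=> le_f; rewrite -[X in X \in _]setD0; apply: (leaves_complete (r := 0)).
- exact: inv_start.
- exact: sub0set.
- exact: vXS.
- by move=> Q _ _ _; rewrite addn0.
- by rewrite cut_net_cap crossing_XS setD0 addnn.
Qed.

End Important.

End Branching.

(** * A higher-order syntax for programs *)

(* Terms are parameterized by the number of variables in scope, and variables
   are de Bruijn levels, so that binders are those of Rocq. *)
Definition hterm := nat -> expr.

Definition hvar l : hterm := fun d => EVar (d - l.+1).
Definition hleaf : hterm := fun=> ELeaf.
Definition hnode (a b : hterm) : hterm := fun d => ENode (a d) (b d).
Definition hlet (a : hterm) (f : hterm -> hterm) : hterm :=
  fun d => ELet (a d) (f (hvar d) d.+1).
(** The left subtree has index 0, which is the higher of the two new levels. *)
Definition hcase (a b : hterm) (f : hterm -> hterm -> hterm) : hterm :=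
  fun d => ECase (a d) (b d) (f (hvar d.+1) (hvar d) d.+2).
Definition hcall i (a : hterm) : hterm := fun d => ECall i (a d).
Definition hflip : hterm := fun=> EFlip.
Definition hpair a f := hcase a hleaf f.
Definition htrue := hnode hleaf hleaf.
Definition hfun (f : hterm -> hterm) : expr := f (hvar 0) 1.

Declare Scope hterm_scope.
Delimit Scope hterm_scope with H.
Bind Scope hterm_scope with hterm.
Notation "( x ; y )" := (hnode x y) : hterm_scope.
Notation "'LET' x := a 'IN' b" := (hlet a (fun x => b))
  (at level 200, x name, b at level 200) : hterm_scope.
Notation "'LET' ( x , y ) := a 'IN' b" := (hpair a (fun x y => b))
  (at level 200, x name, y name, b at level 200) : hterm_scope.
Notation "'CASE' a 'LEAF' b 'NODE' x , y => c" := (hcase a b (fun x y => c))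
  (at level 200, x name, y name, b at level 200, c at level 200) : hterm_scope.

Local Open Scope hterm_scope.

(** * The functions of the program *)

Definition f_getat := 1.
Definition f_setat := 2.
Definition f_dec := 3.
Definition f_inc := 4.
Definition f_augment := 5.
Definition f_scan := 6.
Definition f_round := 7.
Definition f_rounds := 8.
Definition f_pick := 9.
Definition f_search := 10.
Definition f_unary := 11.
Definition f_double := 12.
Definition f_flips := 13.
Definition f_draw := 14.
Definition f_zeros := 15.
Definition f_outrow := 16.
Definition f_graph := 17.
Definition f_targets := 18.
Definition f_any := 19.
Definition f_loop := 20.

Definition e_getat := hfun (fun a =>
  LET (i, l) := a IN LET (x, l') := l IN
  CASE i LEAF x NODE _z, i' => hcall f_getat (i'; l')).

Definition e_setat := hfun (fun a =>
  LET (i, b) := a IN LET (x, l) := b IN LET (y, l') := l IN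
  CASE i LEAF (x; l') NODE _z, i' =>
  hnode y (hcall f_setat (hnode i' (x; l')))).

(* An entry of the capacity matrix is a unary number, ending in [Leaf] or in
   [tinf] for an infinite capacity. *)
Definition tinf := Node (Node Leaf Leaf) Leaf.

Definition hinf : hterm := (htrue; hleaf).

(** An entry equal to [tinf] has no finite unit to lose and is kept, in accordance with the
    truncation in [decm]. *)
Definition e_dec := hfun (fun a =>
  LET (m, b) := a IN LET (x, y) := b IN
  LET (h, row) := hcall f_getat (x; m) IN
  LET e := hcall f_getat (y; row) IN
  LET e' := CASE e LEAF hleaf NODE c, d => (CASE c LEAF d NODE _z, _z' => e) IN
  hcall f_setat (hnode x (hnode (hnode h (hcall f_setat (hnode y (e'; row)))) m))).

Definition e_inc := hfun (fun a =>
  LET (m, b) := a IN LET (x, y) := b IN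
  LET (h, row) := hcall f_getat (x; m) IN
  LET e := hcall f_getat (y; row) IN
  hcall f_setat (hnode x (hnode (hnode h (hcall f_setat (hnode y (hnode (hleaf; e) row)))) m))).

Definition e_augment := hfun (fun a =>
  LET (m, q) := a IN
  CASE q LEAF m NODE x, q' =>
  CASE q' LEAF m NODE y, _z =>
  LET m1 := hcall f_dec (hnode m (x; y)) IN
  LET m2 := hcall f_inc (hnode m1 (y; x)) IN
  hcall f_augment (m2; q')).

Definition e_scan := hfun (fun a =>
  LET (h, b) := a IN LET (row, p) := b IN
  CASE row LEAF hleaf NODE e, row' =>
  LET (q, p') := p IN
  CASE e LEAF hcall f_scan (hnode h (row'; p')) NODE _z, _z' =>
  CASE q LEAF hcall f_scan (hnode h (row'; p')) NODE _z, _z' => (h; q)).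

Definition e_round := hfun (fun a =>
  LET (m, b) := a IN LET (l, p) := b IN
  CASE m LEAF hleaf NODE r, m' =>
  LET (q, l') := l IN
  LET (h, row) := r IN
  LET q' := CASE q LEAF hcall f_scan (hnode h (row; p)) NODE _z, _z' => q IN
  hnode q' (hcall f_round (hnode m' (l'; p)))).

(** The counter [f] is used only through its length; the capacity matrix itself can serve, as it has
    one row per node. *)
Definition e_rounds := hfun (fun a =>
  LET (f, b) := a IN LET (m, p) := b IN
  CASE f LEAF p NODE _z, f' =>
  hcall f_rounds (hnode f' (hnode m (hcall f_round (hnode m (p; p)))))).

Definition e_pick := hfun (fun a =>
  LET (p, u) := a IN
  CASE p LEAF hleaf NODE p1, b =>
  LET (p2, p') := b IN LET (x, u') := u IN
  LET c := hcall f_pick (p'; u') IN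
  CASE p1 LEAF (CASE p2 LEAF c NODE _z, q =>
                CASE q LEAF c NODE _z, _z' => (p2; x))
  NODE _z, _z' => c).

(** The leaves are not listed: the search only decides whether one of them is contained in the
    random set [u], and skips the deletion branch when the picked vertex is not in it. *)
Definition e_search := hfun (fun a =>
  LET (f, b) := a IN LET (m, b1) := b IN LET (s, b2) := b1 IN LET (t, u) := b2 IN
  LET p := hcall f_rounds (hnode m (m; t)) IN
  LET ps := hcall f_getat (s; p) IN
  CASE ps
  LEAF (
    LET c := hcall f_pick (p; u) IN
    CASE c LEAF htrue NODE q, x =>
    CASE f LEAF hleaf NODE _z, f' =>
    LET (h, _z') := q IN
    LET r := CASE x LEAF hleaf NODE _y, _y' =>
      (LET t' := hcall f_setat (hnode h (hnode (h; hleaf) t)) IN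
       hcall f_search (hnode f' (hnode m (hnode s (t'; u))))) IN
    CASE r LEAF (
      LET m' := hcall f_augment (m; q) IN
      hcall f_search (hnode f' (hnode m' (hnode h (t; u)))))
    NODE _y, _y' => htrue)
  NODE _z, _z' =>
    CASE f LEAF hleaf NODE _y, f' =>
    LET m' := hcall f_augment (m; ps) IN
    hcall f_search (hnode f' (hnode m' (hnode s (t; u))))).

Definition e_unary := hfun (fun a =>
  CASE a LEAF hleaf NODE b, a' =>
  LET n := hcall f_double (hcall f_unary a') IN
  CASE b LEAF n NODE _z, _z' => (hleaf; n)).

Definition e_double := hfun (fun a =>
  CASE a LEAF hleaf NODE _z, a' => hnode hleaf (hnode hleaf (hcall f_double a'))).

(* All coins are tossed even after a failure, so that each vertex owns a fixed
   block of random bits. *)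
Definition e_flips := hfun (fun a =>
  CASE a LEAF htrue NODE _z, a' =>
  LET b := hflip IN
  LET r := hcall f_flips a' IN
  CASE b LEAF hleaf NODE _y, _y' => r).

Definition e_draw := hfun (fun a =>
  LET (l, q) := a IN
  CASE l LEAF hleaf NODE _z, l' =>
  LET b := hcall f_flips q IN
  hnode b (hcall f_draw (l'; q))).

Definition e_zeros := hfun (fun a =>
  CASE a LEAF hleaf NODE _z, a' => hnode hleaf (hnode hleaf (hcall f_zeros a'))).

Definition e_outrow := hfun (fun a =>
  CASE a LEAF hleaf NODE b, a' =>
  LET e := CASE b LEAF hleaf NODE _z, _z' => hinf IN
  hnode e (hnode hleaf (hcall f_outrow a'))).

Definition e_graph := hfun (fun a =>
  LET (i, b) := a IN LET (z, b1) := b IN LET (vinf, rows) := b1 IN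
  CASE rows LEAF hleaf NODE row, rows' =>
  LET (v, vinf') := vinf IN
  LET e := CASE v LEAF hleaf NODE _z, _z' => hinf IN
  LET j := (hleaf; i) IN
  LET r1 := hcall f_setat (hnode j (hnode (hleaf; e) z)) IN
  LET r2 := hcall f_outrow row IN
  hnode (i; r1) (hnode (j; r2)
    (hcall f_graph (hnode (hleaf; j) (hnode z (vinf'; rows')))))).

Definition e_targets := hfun (fun a =>
  LET (i, t) := a IN
  CASE t LEAF hleaf NODE b, t' =>
  LET j := (hleaf; i) IN
  LET r := hcall f_targets (hnode (hleaf; j) t') IN
  CASE b LEAF hnode hleaf (hleaf; r)
  NODE _z, _z' => hnode (i; hleaf) (hnode (j; hleaf) r)).

Definition e_any := hfun (fun a =>
  CASE a LEAF hleaf NODE b, a' =>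
  CASE b LEAF hcall f_any a' NODE _z, _z' => htrue).

Definition e_loop := hfun (fun a =>
  LET (i, b) := a IN LET (g, b1) := b IN LET (l, ctx) := b1 IN
  CASE l LEAF hleaf NODE x, l' =>
  LET (f, c) := ctx IN LET (m, c1) := c IN
  LET j := (hleaf; i) IN
  LET r := CASE g LEAF hleaf NODE _z, _z' =>
    (CASE x LEAF hcall f_search (hnode f (hnode m (hnode j c1))) NODE _y, _y' => hleaf) IN
  hnode r (hcall f_loop (hnode (hleaf; j) (hnode g (l'; ctx))))).

(** [f] is the fuel [2k] and [q] the number [4(k+1)] of coins tossed per vertex. *)
Definition e_main := hfun (fun a =>
  LET (arcs, b) := a IN LET (vinf, b1) := b IN LET (t, b2) := b1 IN LET (kb, _z) := b2 IN
  LET k := hcall f_unary kb IN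
  LET f := hcall f_double k IN
  LET q := hcall f_double (hcall f_double (hleaf; k)) IN
  LET u := hcall f_draw (t; q) IN
  LET z := hcall f_zeros t IN
  LET m := hcall f_graph (hnode hleaf (hnode z (vinf; arcs))) IN
  LET p := hcall f_targets (hleaf; t) IN
  LET g := hcall f_any t IN
  hcall f_loop (hnode hleaf (hnode g (hnode t (hnode f (hnode m (p; u))))))).

Definition prog : program := Eval cbv in
  [:: e_main; e_getat; e_setat; e_dec; e_inc; e_augment; e_scan; e_round; e_rounds;
      e_pick; e_search; e_unary; e_double; e_flips; e_draw; e_zeros; e_outrow;
      e_graph; e_targets; e_any; e_loop].

Local Close Scope hterm_scope.

(** * Evaluation within a time bound *)

Definition runs_in env e w v w' b := exists2 t, t <= b & eval prog env e w v w' t.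

Definition computes f a v b := forall w, runs_in [:: a] (nth ELeaf prog f) w v w b.

Lemma runs_in_leq env e w v w' b b' :
  runs_in env e w v w' b -> b <= b' -> runs_in env e w v w' b'.
Proof. by move=> [t tb ev] bb; exists t => //; apply: leq_trans bb. Qed.

Lemma runs_in_var env i w v : onth env i = Some v -> runs_in env (EVar i) w v w 1.
Proof. by exists 1 => //; apply: EvVar. Qed.

Lemma runs_in_leaf env w : runs_in env ELeaf w Leaf w 1.
Proof. by exists 1 => //; apply: EvLeaf. Qed.

Lemma runs_in_flip env b w : runs_in env EFlip (b :: w) (enc_bool b) w 1.
Proof. by exists 1 => //; apply: EvFlip. Qed.

Lemma runs_in_node env e1 e2 w0 w1 w2 v1 v2 b1 b2 :
    runs_in env e1 w0 v1 w1 b1 -> runs_in env e2 w1 v2 w2 b2 ->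
  runs_in env (ENode e1 e2) w0 (Node v1 v2) w2 (b1 + b2).+1.
Proof.
move=> [t1 l1 ev1] [t2 l2 ev2]; exists (t1 + t2).+1; first by rewrite ltnS leq_add.
exact: EvNode ev1 ev2.
Qed.

Lemma runs_in_let env e1 e2 w0 w1 w2 v1 v b1 b2 :
    runs_in env e1 w0 v1 w1 b1 -> runs_in (v1 :: env) e2 w1 v w2 b2 ->
  runs_in env (ELet e1 e2) w0 v w2 (b1 + b2).+1.
Proof.
move=> [t1 l1 ev1] [t2 l2 ev2]; exists (t1 + t2).+1; first by rewrite ltnS leq_add.
exact: EvLet ev1 ev2.
Qed.

Lemma runs_in_case env e e1 e2 w0 w1 w2 u v b1 b2 :
    runs_in env e w0 u w1 b1 ->
    match u with
    | Leaf => runs_in env e1 w1 v w2 b2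
    | Node l r => runs_in [:: l, r & env] e2 w1 v w2 b2
    end ->
  runs_in env (ECase e e1 e2) w0 v w2 (b1 + b2).+1.
Proof.
move=> [t1 l1 ev1]; case: u ev1 => [|l r] ev1 [t2 l2 ev2]; exists (t1 + t2).+1.
- by rewrite ltnS leq_add.
- exact: EvCaseLeaf ev1 ev2.
- by rewrite ltnS leq_add.
- exact: EvCaseNode ev1 ev2.
Qed.

Lemma runs_in_call env f e w0 w1 w2 a v b1 b2 :
    runs_in env e w0 a w1 b1 -> (f < size prog) = true ->
    runs_in [:: a] (nth ELeaf prog f) w1 v w2 b2 ->
  runs_in env (ECall f e) w0 v w2 (b1 + b2).+1.
Proof.
move=> [t1 l1 ev1] fP [t2 l2 ev2]; exists (t1 + t2).+1; first by rewrite ltnS leq_add.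
apply: EvCall ev1 _ ev2.
(* 21 is the number of functions in [prog]. *)
by do 21 case: f fP => [//|f] fP.
Qed.

Lemma computes_leq f a v b b' : computes f a v b -> b <= b' -> computes f a v b'.
Proof. by move=> H bb w; apply: runs_in_leq (H w) bb. Qed.

Ltac whnf_scrutinee :=
  lazymatch goal with
  | |- match ?u with Leaf => ?a | Node l r => @?b l r end =>
      let u' := eval hnf in u in
      lazymatch u' with
      | Leaf => change a
      | Node ?l ?r => let b' := eval cbv beta in (b l r) in change b'
      end
  end.

(* Symbolic evaluation; [call] must solve the evaluation of function calls. *)
Ltac run_with call :=
  lazymatch goal with
  | |- runs_in _ (EVar _) _ _ _ _ => apply: runs_in_var; reflexivity
  | |- runs_in _ ELeaf _ _ _ _ => apply: runs_in_leaf
  | |- runs_in _ EFlip _ _ _ _ => apply: runs_in_flip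
  | |- runs_in _ (ENode _ _) _ _ _ _ => eapply runs_in_node; [run_with call | run_with call]
  | |- runs_in _ (ELet _ _) _ _ _ _ => eapply runs_in_let; [run_with call | run_with call]
  | |- runs_in _ (ECase _ _ _) _ _ _ _ =>
      eapply runs_in_case; [run_with call | whnf_scrutinee; run_with call]
  | |- runs_in _ (ECall _ _) _ _ _ _ =>
      eapply runs_in_call; [run_with call | reflexivity | call]
  end.

Ltac runs_with call :=
  eapply runs_in_leq; [
    lazymatch goal with |- runs_in _ (nth ELeaf prog ?f) _ _ _ _ =>
      let e := eval vm_compute in (nth ELeaf prog f) in
      change (nth ELeaf prog f) with e
    end; run_with call | ].

Ltac computes_with call := let w := fresh "w" in move=> w; runs_with call.

(** * Arithmetic and list functions *)

Definition num i : tree := iter i (Node Leaf) Leaf.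

Lemma getat_computes s i : i < size s ->
  computes f_getat (Node (num i) (enc_seq s)) (nth Leaf s i) (10 * size s).
Proof.
elim: s i => [|x s IH] [|i] //= le_i.
  by computes_with fail; lia.
by computes_with ltac:(apply: (IH i le_i)); lia.
Qed.

Lemma size_consE (A : Type) (x : A) s : size (x :: s) = (size s).+1.
Proof. by []. Qed.

Lemma setat_computes s i v : i < size s ->
  computes f_setat (Node (num i) (Node v (enc_seq s)))
    (enc_seq (set_nth Leaf s i v)) (20 * size s).
Proof.
elim: s i => [|x s IH] [|i] //= le_i.
  by computes_with fail; lia.
by computes_with ltac:(apply: (IH i le_i)); lia.
Qed.

Lemma double_computes i : computes f_double (num i) (num i.*2) (10 * i.+1).
Proof.
elim: i => [|i IH]; first by computes_with fail; lia.
by rewrite doubleS; computes_with ltac:(apply: IH); lia.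
Qed.

Definition nat_of_bits (s : seq bool) : nat := foldr (fun (b : bool) n => b + n.*2) 0 s.

(** The costs of the successive doublings form a geometric sum, so the total is linear in the value
    and the number of digits. *)
Lemma unary_computes s :
  computes f_unary (enc_bits s) (num (nat_of_bits s)) (20 * (nat_of_bits s + size s).+1).
Proof.
elim: s => [|b s IH]; first by computes_with fail; lia.
case: b; computes_with ltac:(first [apply: IH | apply: double_computes]); rewrite /=; lia.
Qed.

Lemma nat_of_bits_bits k : nat_of_bits (bits k) = k.
Proof.
(* Generalized to the digits from position [j] on, which represent the quotient by [2 ^ j]. *)
have main n : forall j, k < 2 ^ (j + n) ->
    nat_of_bits (mkseq (fun i => odd (k %/ 2 ^ (j + i))) n) = k %/ 2 ^ j.
  elim: n => [|n IH] j; first by rewrite addn0 => /divn_small ->.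
  rewrite addnS -addSn => /IH IHj.
  rewrite /mkseq [iota _ _]/= -[1]addn0 iotaDl [map _ _]/= -map_comp addn0.
  rewrite [nat_of_bits _]/=.
  under eq_map => i do rewrite /= add1n addnS -addSn.
  by rewrite -/(mkseq _ n) IHj expnSr divnMA divn2 addn0 odd_double_half.
rewrite /bits; have := main _ 0 (trunc_log_ltn k (isT : 1 < 2)).
by rewrite expn0 divn1.
Qed.

Lemma size_bits k : size (bits k) <= k.+1.
Proof.
rewrite size_mkseq ltnS; case: k => // k.
by apply: leq_trans (ltnW (ltn_expl _ (isT : 1 < 2))) (trunc_logP _ _).
Qed.

(** * Encoded networks and the cost of the search *)

Section NetworkSpec.
Variables (V : finType) (arc : rel V) (Vinf T U : {set V}).
Local Notation N := (V * bool)%type.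
Local Notation inf := (net_inf arc Vinf).
Local Notation nodes := (nodes V).
Local Notation cap := (@net_cap V).
Implicit Types (x y : N) (m : N -> N -> nat) (p : N -> seq N).

Lemma nodes_of_uniq (l : seq V) : uniq l -> uniq (nodes_of l).
Proof.
elim: l => //= v l IH /andP[vl ul]; rewrite !inE !mem_nodes_of /= (negbTE vl) IH //.
by rewrite xpair_eqE andbF.
Qed.

Lemma nodes_uniq : uniq nodes.
Proof. by apply/nodes_of_uniq/enum_uniq. Qed.

Lemma size_nodes_of (l : seq V) : size (nodes_of l) = (size l).*2.
Proof. by elim: l => //= v l ->. Qed.

Definition node_id x := index x nodes.

Definition tab (f : N -> tree) := enc_seq [seq f x | x <- nodes].

Definition nb_nodes := size nodes.

Lemma eq_tab f g : f =1 g -> tab f = tab g.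
Proof. by move=> fg; rewrite /tab (eq_map fg). Qed.

Lemma node_id_lt x : node_id x < nb_nodes.
Proof. by rewrite /nb_nodes index_mem mem_nodes. Qed.

Lemma getat_tab f x : computes f_getat (Node (num (node_id x)) (tab f)) (f x) (10 * nb_nodes).
Proof.
have := @getat_computes [seq f x | x <- nodes] (node_id x).
by rewrite size_map (nth_map x) ?nth_index ?mem_nodes ?node_id_lt // => /(_ isT).
Qed.

Lemma setat_tab f x v : computes f_setat (Node (num (node_id x)) (Node v (tab f)))
  (tab (fun z => if z == x then v else f z)) (20 * nb_nodes).
Proof.
have := @setat_computes [seq f x | x <- nodes] (node_id x) v.
rewrite size_map node_id_lt => /(_ isT).
suff -> : set_nth Leaf [seq f x0 | x0 <- nodes] (node_id x) v =
   [seq (if z == x then v else f z) | z <- nodes] by [].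
apply: (@eq_from_nth _ Leaf) => [|i].
  by rewrite size_set_nth !size_map; apply/maxn_idPr; rewrite node_id_lt.
rewrite size_set_nth size_map (maxn_idPr _) ?node_id_lt // => lt_i.
rewrite nth_set_nth /= !(nth_map x) //.
suff -> : (nth x nodes i == x) = (i == node_id x) by [].
by rewrite -{2}(nth_index x (mem_nodes x)) nth_uniq ?nodes_uniq ?node_id_lt.
Qed.

Definition enc_cap (i : bool) c : tree := iter c (Node Leaf) (if i then tinf else Leaf).

Definition enc_row m x := enc_seq [seq enc_cap (inf x y) (m x y) | y <- nodes].

Definition enc_net m := tab (fun x => Node (num (node_id x)) (enc_row m x)).

Definition enc_path (q : seq N) := enc_seq [seq num (node_id x) | x <- q].

Definition enc_paths p := tab (fun x => enc_path (p x)).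

Lemma dec_computes m x y :
  computes f_dec (Node (enc_net m) (Node (num (node_id x)) (num (node_id y))))
    (enc_net (decm m x y)) (80 * nb_nodes.+1).
Proof.
pose dec e := match e with Node Leaf b => b | _ => e end.
have -> : enc_net (decm m x y) = tab (fun z => if z == x
    then Node (num (node_id x)) (tab (fun z' => if z' == y
      then dec (enc_cap (inf x y) (m x y)) else enc_cap (inf x z') (m x z')))
    else Node (num (node_id z)) (enc_row m z)).
  apply: eq_tab => z; rewrite /decm; have [->|zx] := eqVneq z x; congr Node.
    apply: eq_tab => z'; rewrite eqxx; have [->|//] := eqVneq z' y.
    by case: (m x y) => //=; case: (inf _ _).
  by apply: eq_tab => z'; rewrite (negbTE zx).
have := getat_tab (fun z' => enc_cap (inf x z') (m x z')) y.
move: (enc_cap (inf x y) (m x y)) => e ge.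
case: e ge => [|[|e1 e2] e] ge; computes_with ltac:(first [
  apply: (getat_tab (fun x => Node (num (node_id x)) (enc_row m x)))
 | apply: ge | apply: (setat_tab (fun z' => enc_cap (inf x z') (m x z')))
 | apply: (setat_tab (fun x => Node (num (node_id x)) (enc_row m x)))]); lia.
Qed.

Lemma inc_computes m x y :
  computes f_inc (Node (enc_net m) (Node (num (node_id x)) (num (node_id y))))
    (enc_net (incm m x y)) (80 * nb_nodes.+1).
Proof.
have -> : enc_net (incm m x y) = tab (fun z => if z == x
    then Node (num (node_id x)) (tab (fun z' => if z' == y
      then Node Leaf (enc_cap (inf x y) (m x y)) else enc_cap (inf x z') (m x z')))
    else Node (num (node_id z)) (enc_row m z)).
  apply: eq_tab => z; rewrite /incm; have [->|zx] := eqVneq z x; congr Node.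
    by apply: eq_tab => z'; rewrite eqxx; have [->|//] := eqVneq z' y.
  by apply: eq_tab => z'; rewrite (negbTE zx).
computes_with ltac:(first [
  apply: (getat_tab (fun x => Node (num (node_id x)) (enc_row m x)))
 | apply: (getat_tab (fun z' => enc_cap (inf x z') (m x z')))
 | apply: (setat_tab (fun z' => enc_cap (inf x z') (m x z')))
 | apply: (setat_tab (fun x => Node (num (node_id x)) (enc_row m x)))]); lia.
Qed.

Lemma augment_computes m q :
  computes f_augment (Node (enc_net m) (enc_path q)) (enc_net (augment m q))
    (200 * (nb_nodes.+1 * (size q).+1)).
Proof.
elim: q m => [|x [|y q] IH] m; [by computes_with fail; lia.. | ].
computes_with ltac:(first [apply: dec_computes | apply: inc_computes
  | apply: (IH (incm (decm m x y) y x))]).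
rewrite ?size_consE; lia.
Qed.

Lemma scan_computes m p x l :
  computes f_scan (Node (num (node_id x)) (Node (enc_seq [seq enc_cap (inf x y) (m x y) | y <- l])
    (enc_seq [seq enc_path (p y) | y <- l])))
    (enc_path (scan inf m p x l)) (30 * (size l).+1).
Proof.
elim: l => [|y l IH]; first by computes_with fail; lia.
rewrite [map _ _]/= [map (fun y => enc_path _) _]/= [scan _ _ _ _ _]/=.
have [ixy|] := boolP (avail inf m x y); last first.
  rewrite /avail /=; case: (inf x y) => //; case: (m x y) => // _.
  by computes_with ltac:(apply: IH); rewrite ?size_consE; lia.
have [e1 [e2 ->]] : exists e1 e2, enc_cap (inf x y) (m x y) = Node e1 e2.
  move: ixy; rewrite /avail /= /enc_cap.
  by case: (m x y) => [|c]; case: (inf x y) => // _; do 2!eexists.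
case py: (p y) => [|z q]; first by computes_with ltac:(apply: IH); rewrite ?size_consE; lia.
by computes_with fail; rewrite ?size_consE; lia.
Qed.

Lemma round_computes m p l :
  computes f_round
    (Node (enc_seq [seq Node (num (node_id x)) (enc_row m x) | x <- l])
      (Node (enc_seq [seq enc_path (p x) | x <- l]) (enc_paths p)))
    (enc_seq [seq enc_path (round inf nodes m p x) | x <- l])
    (60 * (nb_nodes.+1 * (size l).+1)).
Proof.
elim: l => [|x l IH]; first by computes_with fail; lia.
rewrite [map _ _]/= [map (fun y => enc_path (p y)) _]/=.
rewrite [map (fun y => enc_path (round _ _ _ _ y)) _]/=.
rewrite {1}/round; case px: (p x) => [|y q].
  computes_with ltac:(first [apply: IH | apply: (scan_computes m p x nodes)]).
  by rewrite -/nb_nodes ?size_consE; lia.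
by computes_with ltac:(apply: IH); rewrite ?size_consE; lia.
Qed.

Lemma rounds_computes m p s :
  computes f_rounds (Node (enc_seq s) (Node (enc_net m) (enc_paths p)))
    (enc_paths (iter (size s) (round inf nodes m) p))
    (100 * (nb_nodes.+1 * nb_nodes.+1 * (size s).+1)).
Proof.
elim: s p => [|e s IH] p; first by computes_with fail; lia.
rewrite size_consE iterSr.
computes_with ltac:(first [apply: IH | apply: (round_computes m p nodes)]).
by rewrite -/nb_nodes; lia.
Qed.

Lemma pick_computes p (l : seq V) :
  computes f_pick (Node (enc_seq [seq enc_path (p x) | x <- nodes_of l])
                        (enc_bits [seq v \in U | v <- l]))
    (if ohead [seq u <- l | (p (u, false) == [::]) && (1 < size (p (u, true)))] is Some u
     then Node (enc_path (p (u, true))) (enc_bool (u \in U)) else Leaf)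
    (30 * (size l).+1).
Proof.
elim: l => [|v l IH]; first by computes_with fail; lia.
rewrite [nodes_of _]/= [map _ _]/= [filter _ _]/=.
case: (p (v, false)) => [|? ?]; last by computes_with ltac:(apply: IH); rewrite ?size_consE; lia.
case pv: (p (v, true)) => [|x [|y q]];
  [by computes_with ltac:(apply: IH); rewrite ?size_consE; lia.. |].
by rewrite [X in computes _ _ X _]/= pv; computes_with ltac:(apply: IH); rewrite ?size_consE; lia.
Qed.

Lemma size_paths m Tp x : size (paths inf nodes m Tp x) <= nb_nodes.
Proof.
have [-> //|/pathsP[q [-> /andP[_ uq] _ _ _]]] := eqVneq (paths inf nodes m Tp x) [::].
by apply: uniq_leq_size uq _ => y _; apply: mem_nodes.
Qed.

Lemma paths_computes m Tp :
  computes f_rounds (Node (enc_net m) (Node (enc_net m) (enc_paths (start_paths Tp))))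
    (enc_paths (paths inf nodes m Tp)) (100 * (nb_nodes.+1 * nb_nodes.+1 * nb_nodes.+1)).
Proof.
have := rounds_computes m (start_paths Tp) [seq Node (num (node_id x)) (enc_row m x) | x <- nodes].
by rewrite size_map.
Qed.

Lemma pick_crossing_computes p :
  computes f_pick (Node (enc_paths p) (enc_set U))
    (if pick_crossing p is Some u
     then Node (enc_path (p (u, true))) (enc_bool (u \in U)) else Leaf) (30 * nb_nodes.+1).
Proof.
apply: computes_leq (pick_computes p (enum V)) _.
by rewrite /nb_nodes size_nodes_of; lia.
Qed.

Lemma mark_computes Tp x :
  computes f_setat (Node (num (node_id x)) (Node (enc_path [:: x]) (enc_paths (start_paths Tp))))
    (enc_paths (start_paths (x |: Tp))) (20 * nb_nodes).
Proof.
have := @setat_tab (fun x => enc_path (start_paths Tp x)) x (enc_path [:: x]).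
rewrite /enc_paths (_ : tab (fun z => if _ then _ else _) =
  tab (fun z => enc_path (start_paths (x |: Tp) z))) //.
by apply: eq_tab => z; rewrite /start_paths in_setU1; case: eqVneq => [->|].
Qed.

Lemma augment_paths_computes m Tp x :
  computes f_augment (Node (enc_net m) (enc_path (paths inf nodes m Tp x)))
    (enc_net (augment m (paths inf nodes m Tp x))) (200 * (nb_nodes.+1 * nb_nodes.+1)).
Proof.
apply: computes_leq (augment_computes _ _) _.
by rewrite leq_mul2l /= leq_mul2l /= ltnS size_paths.
Qed.

Definition search_cost := 500 * (nb_nodes.+1 * nb_nodes.+1 * nb_nodes.+1).

(** The work at one node of the branching: a path table, an augmentation, and several linear
    passes. *)
Lemma search_costE :
  100 * (nb_nodes.+1 * nb_nodes.+1 * nb_nodes.+1) + 200 * (nb_nodes.+1 * nb_nodes.+1)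
    + 200 * nb_nodes.+1 <= search_cost.
Proof.
rewrite /search_cost; move: nb_nodes => l.
have := leq_pmulr (l.+1 * l.+1) (ltn0Sn l); have := leq_pmulr l.+1 (ltn0Sn l).
by move: (l.+1 * l.+1 * l.+1) (l.+1 * l.+1); lia.
Qed.

(** [c] is the number of nodes of a full binary tree of depth [f]. Keeping it abstract leaves only
    linear arithmetic in the cost bounds. *)
Lemma search_computes_rec c f m s Tp :
    c 0 = 1 -> (forall n, c n.+1 = (c n).*2.+1) ->
  computes f_search (Node (num f) (Node (enc_net m) (Node (num (node_id s))
      (Node (enc_paths (start_paths Tp)) (enc_set U)))))
    (enc_bool (has (fun S : {set V} => S \subset U) (leaves arc Vinf f m s Tp)))
    (search_cost * c f).
Proof.
move: search_cost search_costE => K leK c0 cS.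
elim: f m s Tp => [|f IH] m s Tp; rewrite ?c0 ?cS [leaves _ _ _ _ _ _]/=.
all: set p := paths inf nodes m Tp.
all: have gs := getat_tab (fun x => enc_path (p x)) s.
all: have pk := pick_crossing_computes p.
all: case ps: (p s) gs => [|x q] gs /=.
- case E: (pick_crossing p) pk => [u|] pk.
    computes_with ltac:(first [apply: paths_computes | apply: gs | apply: pk]).
    by move: leK; clear; lia.
  rewrite [has _ _]/= sub0set.
  computes_with ltac:(first [apply: paths_computes | apply: gs | apply: pk]).
  by move: leK; clear; lia.
- computes_with ltac:(first [apply: paths_computes | apply: gs | apply: pk]).
  by move: leK; clear; lia.
- case E: (pick_crossing p) pk => [u|] pk; last first.
    rewrite [has _ _]/= sub0set.
    computes_with ltac:(first [apply: paths_computes | apply: gs | apply: pk]).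
    by move: leK; clear; lia.
  have aug := augment_paths_computes m Tp (u, true).
  (* The program reads the number of the picked exit from the head of its path. *)
  have [q pu] : exists q, p (u, true) = (u, true) :: q.
    have := pick_crossing_size E; rewrite -/p => lt1.
    have /pathsP[q []] : p (u, true) != [::] by case: (p _) lt1.
    by exists q.
  rewrite -/p in aug; rewrite pu in aug pk.
  have -> : has (fun S : {set V} => S \subset U)
     ([seq u |: D | D <- leaves arc Vinf f m s ((u, true) |: Tp)] ++
       leaves arc Vinf f (augment m (p (u, true))) (u, true) Tp) =
     (u \in U) && has (fun S : {set V} => S \subset U) (leaves arc Vinf f m s ((u, true) |: Tp))
     || has (fun S : {set V} => S \subset U)
          (leaves arc Vinf f (augment m (p (u, true))) (u, true) Tp).
    rewrite has_cat has_map; congr orb; elim: (leaves _ _ _ _ _ _) => [|S l IHl].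
      by rewrite andbF.
    by rewrite /= IHl subUset sub1set; case: (u \in U).
  have IH1 := IH m s ((u, true) |: Tp).
  have IH2 := IH (augment m (p (u, true))) (u, true) Tp.
  rewrite pu in IH2 *.
  case: (u \in U) pk => pk.
    case: (has _ (leaves arc Vinf f m s _)) IH1 => IH1.
      computes_with ltac:(first [apply: paths_computes | apply: gs | apply: pk
        | apply: IH1 | apply: mark_computes]).
      by move: leK; clear; lia.
    computes_with ltac:(first [apply: paths_computes | apply: gs | apply: pk
      | apply: IH1 | apply: mark_computes | apply: aug | apply: IH2]).
    by move: leK; clear; lia.
  computes_with ltac:(first [apply: paths_computes | apply: gs | apply: pk
    | apply: aug | apply: IH2]).
  by move: leK; clear; lia.
- have aug := augment_paths_computes m Tp s.
  rewrite -/p ps in aug.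
  have IH1 := IH (augment m (x :: q)) s Tp.
  computes_with ltac:(first [apply: paths_computes | apply: gs | apply: IH1
    | apply: aug]).
  by move: leK; clear; lia.
Qed.

Lemma search_computes f m s Tp :
  computes f_search (Node (num f) (Node (enc_net m) (Node (num (node_id s))
      (Node (enc_paths (start_paths Tp)) (enc_set U)))))
    (enc_bool (has (fun S : {set V} => S \subset U) (leaves arc Vinf f m s Tp)))
    (search_cost * 2 ^ f.+1).
Proof.
apply: computes_leq (@search_computes_rec (fun n => (2 ^ n.+1).-1) _ _ _ _ _ _) _ => //.
  by move=> n; rewrite [in LHS]expnS; have := expn_gt0 2 n.+1; move: (2 ^ n.+1); lia.
by rewrite leq_mul2l leq_pred orbT.
Qed.

Lemma nodes_of_cat (l1 l2 : seq V) : nodes_of (l1 ++ l2) = nodes_of l1 ++ nodes_of l2.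
Proof. by rewrite /nodes_of map_cat flatten_cat. Qed.

Lemma node_idE pre v (b : bool) l : enum V = pre ++ v :: l ->
  node_id (v, b) = b + (size pre).*2.
Proof.
move=> enumE; rewrite /node_id /nodes enumE nodes_of_cat index_cat mem_nodes_of /=.
have := enum_uniq V; rewrite enumE cat_uniq => /and3P[_ /hasPn/(_ v) vpre _].
rewrite (negbTE (vpre _)) ?inE ?eqxx // size_nodes_of addnC xpair_eqE eqxx.
by case: b; rewrite //= xpair_eqE !eqxx.
Qed.

Lemma zeros_computes s :
  computes f_zeros (enc_seq s) (enc_seq (nseq (size s).*2 Leaf)) (10 * (size s).+1).
Proof.
elim: s => [|e s IH]; first by computes_with fail; lia.
by rewrite size_consE doubleS; computes_with ltac:(apply: IH); lia.
Qed.

Lemma zeros_set_computes :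
  computes f_zeros (enc_set T) (tab (fun=> Leaf)) (10 * nb_nodes.+1).
Proof.
have := zeros_computes [seq enc_bool b | b <- [seq v \in T | v <- enum V]].
rewrite 2!size_map => zT.
have -> : tab (fun=> Leaf) = enc_seq (nseq (size (enum V)).*2 Leaf).
  by rewrite /tab -size_nodes_of /nodes; elim: nodes_of => //= x l ->.
by refine (computes_leq zT _); rewrite /nb_nodes size_nodes_of; lia.
Qed.

Lemma outrow_computes u (l : seq V) :
  computes f_outrow (enc_bits [seq arc u v | v <- l])
    (enc_seq [seq enc_cap (inf (u, true) y) (net_cap (u, true) y) | y <- nodes_of l])
    (20 * (size l).+1).
Proof.
elim: l => [|v l IH]; first by computes_with fail; lia.
rewrite [map _ _]/= [map _ (nodes_of _)]/= /net_inf /net_cap /=.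
by case: (arc u v); computes_with ltac:(apply: IH); rewrite ?size_consE; lia.
Qed.

Lemma inrow_computes v :
  computes f_setat (Node (num (node_id (v, true)))
      (Node (Node Leaf (if v \in Vinf then tinf else Leaf)) (tab (fun=> Leaf))))
    (enc_row cap (v, false)) (20 * nb_nodes).
Proof.
pose e := Node Leaf (if v \in Vinf then tinf else Leaf).
suff -> : enc_row cap (v, false) = tab (fun z => if z == (v, true) then e else Leaf).
  exact: (setat_tab (fun=> Leaf)).
apply: eq_tab => -[y c]; rewrite /net_inf /net_cap /= xpair_eqE.
by rewrite [y == v]eq_sym; case: c; rewrite ?andbF // ?andbT; case: (v == y).
Qed.

(** The induction runs over a suffix of [enum V], because the numbers of its nodes depend on the
    length of the prefix already treated. *)
Lemma graph_computes pre (l : seq V) : enum V = pre ++ l ->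
  computes f_graph (Node (num (size pre).*2) (Node (tab (fun=> Leaf))
      (Node (enc_bits [seq v \in Vinf | v <- l])
            (enc_seq [seq enc_bits [seq arc u v | v <- enum V] | u <- l]))))
    (enc_seq [seq Node (num (node_id x)) (enc_row cap x) | x <- nodes_of l])
    (100 * (nb_nodes.+1 * (size l).+1)).
Proof.
elim: l pre => [|v l IH] pre enumE; first by computes_with fail; lia.
have {}IH := IH (rcons pre v); rewrite cat_rcons size_rcons in IH.
have {}IH := IH enumE.
have nF := node_idE false enumE; have nT := node_idE true enumE.
rewrite add0n in nF; rewrite add1n in nT.
have := inrow_computes v; rewrite nT => ir.
have := outrow_computes v (enum V) => or.
have szV : (size (enum V)).*2 = nb_nodes by rewrite -size_nodes_of.
rewrite [nodes_of _]/= ![map _ (_ :: _)]/= nF nT.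
case: (v \in Vinf) ir => ir;
  computes_with ltac:(first [apply: ir | apply: or | apply: IH]);
  move: szV; rewrite ?size_consE; clear; lia.
Qed.

Lemma targets_computes pre (l : seq V) : enum V = pre ++ l ->
  computes f_targets (Node (num (size pre).*2) (enc_bits [seq v \in T | v <- l]))
    (enc_seq [seq enc_path (start_paths (net_target T) x) | x <- nodes_of l])
    (30 * (size l).+1).
Proof.
elim: l pre => [|v l IH] pre enumE; first by computes_with fail; lia.
have {}IH := IH (rcons pre v); rewrite cat_rcons size_rcons in IH.
have {}IH := IH enumE.
have nF := node_idE false enumE; have nT := node_idE true enumE.
rewrite add0n in nF; rewrite add1n in nT.
rewrite [nodes_of _]/= ![map _ (_ :: _)]/= /start_paths !inE /= -/(start_paths _).
case: (v \in T); rewrite /enc_path /= ?nF ?nT; 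
  computes_with ltac:(apply: IH); rewrite ?size_consE; lia.
Qed.

Lemma any_computes (l : seq V) :
  computes f_any (enc_bits [seq v \in T | v <- l]) (enc_bool (has [in T] l)) (10 * (size l).+1).
Proof.
elim: l => [|v l IH]; first by computes_with fail; lia.
rewrite /=; case: (v \in T); computes_with ltac:(apply: IH); rewrite ?size_consE; lia.
Qed.

Definition sampled f v := [&& T != set0, v \notin T &
  has (fun S : {set V} => S \subset U) (leaves arc Vinf f cap (v, true) (net_target T))].

Lemma loop_computes f pre (l : seq V) : enum V = pre ++ l ->
  computes f_loop (Node (num (size pre).*2) (Node (enc_bool (T != set0))
      (Node (enc_bits [seq v \in T | v <- l])
        (Node (num f) (Node (enc_net cap)
          (Node (enc_paths (start_paths (net_target T))) (enc_set U)))))))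
    (enc_bits [seq sampled f v | v <- l])
    ((search_cost * 2 ^ f.+1 + 50) * (size l).+1).
Proof.
elim: l pre => [|v l IH] pre enumE; first by computes_with fail; lia.
have {}IH := IH (rcons pre v); rewrite cat_rcons size_rcons in IH.
have {}IH := IH enumE.
have sc := search_computes f cap (v, true) (net_target T).
rewrite (node_idE true enumE) add1n in sc.
rewrite ![map _ (_ :: _)]/= {1}/sampled; move: (search_cost * 2 ^ f.+1) sc IH => K.
case: (T != set0) => sc IH.
  by case: (v \in T); computes_with ltac:(first [apply: sc | apply: IH]);
     rewrite ?size_consE; clear; lia.
by computes_with ltac:(first [apply: sc | apply: IH]); rewrite ?size_consE; clear; lia.
Qed.

End NetworkSpec.

(** * Reading the random bits *)

Lemma flips_runs bs w :
  runs_in [:: num (size bs)] (nth ELeaf prog f_flips) (bs ++ w)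
    (enc_bool (all (fun b => b) bs)) w (20 * (size bs).+1).
Proof.
elim: bs => [|b bs IH]; first by runs_with fail; lia.
by case: b; runs_with ltac:(apply: IH); rewrite ?size_consE; lia.
Qed.

Fixpoint coins q n (w : seq bool) : seq bool :=
  if n is n'.+1 then all (fun b => b) (take q w) :: coins q n' (drop q w) else [::].

Lemma draw_runs q s w : size s * q <= size w ->
  runs_in [:: Node (enc_seq s) (num q)] (nth ELeaf prog f_draw) w
    (enc_bits (coins q (size s) w)) (drop (size s * q) w) (40 * ((size s).+1 * q.+1)).
Proof.
elim: s w => [|e s IH] w; first by rewrite drop0 => _; runs_with fail; lia.
rewrite size_consE mulSn => le_w; rewrite addnC -drop_drop [coins _ _ _]/=.
have := flips_runs (take q w) (drop q w); rewrite cat_take_drop size_takel; last by lia.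
move=> fl; have {}IH := IH (drop q w); rewrite size_drop in IH.
have {}IH := IH ltac:(lia).
by runs_with ltac:(first [apply: fl | apply: IH]); clear; lia.
Qed.

(** * The sampled set *)

Section Sampling.
Variables (V : finType) (arc : rel V) (Vinf T : {set V}) (k : nat).
Local Notation n := (size (enum V)).

(** A vertex is drawn if all its [q] coins show true. This [q] satisfies [2 * k * 4 ^ k <= 2 ^ q],
    as the union bound over the bad leaves demands. *)
Definition nb_coins := (k.+1).*2.*2.
Local Notation q := nb_coins.

Definition coin_set (w : seq bool) : {set V} :=
  [set v | nth false (coins q n w) (index v (enum V))].

Lemma size_coins i w : size (coins q i w) = i.
Proof. by elim: i w => //= i IH w; rewrite IH. Qed.

Lemma enc_coin_set w : enc_set (coin_set w) = enc_bits (coins q n w).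
Proof.
rewrite /enc_set; congr enc_bits; apply: (@eq_from_nth _ false).
  by rewrite size_map size_coins.
move=> i; rewrite size_map => lti.
have v0 : V by case: (enum V) lti => // v.
by rewrite (nth_map v0) // inE index_uniq ?enum_uniq.
Qed.

Definition sample w : {set V} := [set v | sampled arc Vinf T (coin_set w) k.*2 v].

Lemma unary_bits_computes : computes f_unary (enc_bits (bits k)) (num k) (40 * k.+1).
Proof.
have := unary_computes (bits k); rewrite nat_of_bits_bits => uk.
by apply: computes_leq uk _; have := size_bits k; lia.
Qed.

Lemma any_target_computes :
  computes f_any (enc_set T) (enc_bool (T != set0)) (10 * n.+1).
Proof.
have -> : (T != set0) = has [in T] (enum V).
  apply/set0Pn/hasP => [[v vT]|[v _ vT]]; exists v => //.
  by rewrite mem_enum.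
exact: any_computes.
Qed.

Definition main_cost :=
  search_cost V * 2 ^ (k.*2).+1 * (nb_nodes V).+1
    + 1000 * ((nb_nodes V).+1 * (nb_nodes V).+1 * k.+1).

Lemma main_runs w : n * q <= size w ->
  runs_in [:: enc_input arc Vinf T k] (nth ELeaf prog 0) w (enc_set (sample w))
    (drop (n * q) w) main_cost.
Proof.
move=> le_w.
have loop := loop_computes arc Vinf T (coin_set w) k.*2 (erefl : enum V = [::] ++ _).
have graph := graph_computes arc Vinf (erefl : enum V = [::] ++ _).
have targets := targets_computes T (erefl : enum V = [::] ++ _).
have -> : enc_set (sample w) =
  enc_bits [seq sampled arc Vinf T (coin_set w) k.*2 v | v <- enum V].
  by rewrite /enc_set /sample; congr enc_bits; apply: eq_map => v; rewrite inE.
have sT : size [seq enc_bool b | b <- [seq v \in T | v <- enum V]] = n by rewrite 2!size_map.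
have := @draw_runs q [seq enc_bool b | b <- [seq v \in T | v <- enum V]] w.
rewrite sT -enc_coin_set => /(_ le_w) draw.
runs_with ltac:(first [apply: unary_bits_computes | apply: double_computes
  | apply: (double_computes k.+1) | apply: draw | apply: zeros_set_computes
  | apply: graph | apply: targets
  | apply: any_target_computes | apply: loop]).
have szV : n.*2 = nb_nodes V by rewrite -size_nodes_of.
rewrite /main_cost /nb_coins.
move: szV (search_cost V * _) => szV K.
move: szV; clear; lia.
Qed.

End Sampling.

(** * Counting coin tosses *)

(** A tuple is determined by the positions where it is false; those that are true on [J] correspond
    to the subsets of the complement of [J]. *)
Lemma card_tuple_all_true B (J : {set 'I_B}) :
  #|[set w : B.-tuple bool | [forall j in J, tnth w j]]| = 2 ^ (B - #|J|).
Proof.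
pose g (w : B.-tuple bool) : {set 'I_B} := [set j | ~~ tnth w j].
have g_inj : injective g.
  move=> w1 w2 /setP eqg; apply: eq_from_tnth => j.
  by have := eqg j; rewrite !inE => /negb_inj.
rewrite -(card_imset _ g_inj).
have -> : g @: [set w : B.-tuple bool | [forall j in J, tnth w j]] = powerset (~: J).
  apply/setP => D; rewrite powersetE; apply/imsetP/subsetP.
    move=> [w]; rewrite inE => /forall_inP Jw -> j; rewrite !inE.
    by apply: contra => /Jw.
  move=> DJ; exists [tuple j \notin D | j < B].
    rewrite inE; apply/forall_inP => j jJ; rewrite tnth_mktuple.
    by apply/negP => /DJ; rewrite inE jJ.
  by apply/setP => j; rewrite inE tnth_mktuple negbK.
by rewrite card_powerset cardsCs setCK card_ord.
Qed.

Section Counting.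
Variables (V : finType) (k B : nat).
Local Notation n := (size (enum V)).
Local Notation q := (nb_coins k).
Hypothesis leB : n * q <= B.

Lemma coin_subproof (x : V * 'I_q) : index x.1 (enum V) * q + x.2 < B.
Proof.
apply: leq_trans leB; apply: (@leq_trans ((index x.1 (enum V)).+1 * q)).
  by rewrite mulSn addnC ltn_add2r.
by rewrite leq_mul2r index_mem mem_enum orbT.
Qed.

Definition coin x : 'I_B := Ordinal (coin_subproof x).

Lemma coin_inj : injective coin.
Proof.
move=> [u i] [v j] /(congr1 val) /= eqc.
have q0 : 0 < q by [].
have ei : index u (enum V) = index v (enum V).
  by have := congr1 (fun a => a %/ q) eqc; rewrite !divnMDl // !divn_small // !addn0.
have -> : u = v.
  by rewrite -(nth_index u (mem_enum V u)) ei nth_index ?mem_enum.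
congr pair; apply: val_inj; move: eqc; rewrite ei => /eqP.
by rewrite eqn_add2l => /eqP.
Qed.

Lemma nth_coins i j w : i < j ->
  nth false (coins q j w) i = all (fun b => b) (take q (drop (i * q) w)).
Proof.
elim: j i w => // j IH [|i] w lti /=; first by rewrite drop0.
by rewrite IH // drop_drop mulSn addnC.
Qed.

Lemma in_coin_set (w : B.-tuple bool) v :
  (v \in coin_set V k w) = [forall i, tnth w (coin (v, i))].
Proof.
rewrite inE nth_coins ?index_mem ?mem_enum //.
set d := index v _ * q.
have szd : size (take q (drop d w)) = q.
  have led : d + q <= B.
    apply: leq_trans leB; rewrite /d addnC -mulSn leq_mul2r index_mem mem_enum.
    by rewrite orbT.
  by rewrite size_takel // size_drop size_tuple; move: led; clear; lia.
apply/(all_nthP false)/forallP => [H i|H i].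
  have := H i; rewrite szd ltn_ord => /(_ isT).
  by rewrite nth_take // nth_drop (tnth_nth false).
rewrite szd => lti; have := H (Ordinal lti).
by rewrite nth_take // nth_drop (tnth_nth false).
Qed.

(** Distinct vertices own disjoint blocks of coins, so the event prescribes exactly [#|A| * q]
    tosses. *)
Lemma card_coin_set (A : {set V}) :
  #|[set w : B.-tuple bool | A \subset coin_set V k w]| = 2 ^ (B - #|A| * q).
Proof.
have <- : #|coin @: setX A [set: 'I_q]| = #|A| * q.
  by rewrite (card_imset _ coin_inj) cardsX cardsT card_ord.
rewrite -card_tuple_all_true; congr #|pred_of_set _|; apply/setP => w; rewrite !inE.
apply/subsetP/forall_inP => [AU _ /imsetP[[v i] + ->]|AU v vA].
  by rewrite !inE andbT /= => /AU; rewrite in_coin_set => /forallP.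
rewrite in_coin_set; apply/forallP => i; apply: AU; apply/imsetP.
by exists (v, i); rewrite // !inE vA.
Qed.

End Counting.

(** * The probability of success *)

Lemma separator_sub (V : finType) (arc : rel V) (Vinf A B W W' : {set V}) :
    separator arc Vinf A B W -> W \subset W' -> W' \subset ~: (A :|: B :|: Vinf) ->
  separator arc Vinf A B W'.
Proof.
case/and5P=> A0 B0 AB _ /forall_inP nc WW' sW'; apply/and5P; split=> //.
apply/forall_inP => a aA; apply/forall_inP => b bB.
have /forall_inP/(_ b bB) := nc a aA; apply: contra; apply: connect_sub => x y.
case/and3P=> axy xW yW; apply: connect1.
by rewrite /arcD /= axy (contra (subsetP WW' _) xW) (contra (subsetP WW' _) yW).
Qed.

Section Probability.
Variables (V : finType) (arc : rel V) (Vinf T : {set V}) (k B : nat) (W Y : {set V}).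
Local Notation n := (size (enum V)).
Local Notation q := (nb_coins k).
Hypotheses (leB : n * q <= B) (sW : W \subset ~: (T :|: Vinf)).
Hypotheses (thinW : thin arc Vinf T W) (leW : #|W| <= k).
Hypothesis impY : forall v, v \in Y -> exists2 W' : {set V},
  W' \subset W & important_separator arc Vinf [set v] T W'.

Local Notation Z := (sample arc Vinf T k).
Local Notation lv x := (leaves arc Vinf k.*2 (@net_cap V) (x, true) (net_target T)).

Let G := [set w : B.-tuple bool | W \subset coin_set V k w].
Let E := [set w : B.-tuple bool | [disjoint W & Z w] && (Y \subset Z w)].
Let bad (S : {set V}) := [set w : B.-tuple bool | (W :|: S) \subset coin_set V k w].

(** A leaf inside [W] avoids [x], so [W :\ x] would contain it and separate [x] from [T],
    contradicting thinness. *)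
Lemma leaf_not_sub x S : T != set0 -> x \in W -> S \in lv x -> ~~ (S \subset W).
Proof.
move=> T0 xW Sl; apply/negP => SW.
have := subsetP sW _ xW; rewrite !inE negb_or => /andP[xT xI].
have sepS := leaves_separator T0 xT (inv_start arc Vinf T x) Sl; rewrite set0U in sepS.
have /forall_inP/(_ x xW) := thinW; rewrite inE => /negP[].
have /and5P[_ _ _ /subsetP sS _] := sepS.
apply: separator_sub sepS _ _; apply/subsetP => y.
  move=> yS; rewrite !inE (subsetP SW) // andbT.
  by have := sS y yS; rewrite !inE !negb_or => /andP[/andP[]].
rewrite !inE => /andP[yx yW]; have := subsetP sW _ yW.
by rewrite !inE !negb_or yx.
Qed.

(** Some [y] of [S] lies outside [W], and its [q] coins must all succeed in addition to those of
    [W]. *)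
Lemma card_bad x S : T != set0 -> x \in W -> S \in lv x -> #|bad S| * 2 ^ q <= #|G|.
Proof.
move=> T0 xW Sl; have /subsetPn[y yS yW] := leaf_not_sub T0 xW Sl.
have cWy : #|y |: W| = #|W|.+1 by rewrite cardsU1 yW.
(* The coins of [y |: W] fit into the [B] tosses, so the truncated subtractions in the exponents are
   exact. *)
have leWy : (#|W|).+1 * q <= B.
  by apply: leq_trans leB; rewrite leq_mul2r -cWy -cardE max_card orbT.
rewrite (card_coin_set leB W).
apply: (@leq_trans (2 ^ (B - #|W|.+1 * q) * 2 ^ q)).
  rewrite leq_mul2r -cWy -(card_coin_set leB (y |: W)) subset_leq_card ?orbT //.
  apply/subsetP => w; rewrite !inE; apply: subset_trans.
  by rewrite subUset sub1set inE yS orbT subsetUl.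
by rewrite -expnD leq_exp2l //; move: leWy; rewrite mulSn; lia.
Qed.

(** When [W] is drawn, [Y] is sampled because its important separators are leaves inside [W].
    Failure then means that some [x] in [W] is sampled, through a leaf that was drawn too. *)
Lemma good_toss : G \subset E :|: \bigcup_(x in W | T != set0) \bigcup_(S <- lv x) bad S.
Proof.
apply/subsetP => w; rewrite inE => WU; rewrite in_setU; apply/orP.
have [|nE] := boolP (w \in E); [by left|right].
have YZ : Y \subset Z w.
  apply/subsetP => y /impY[W' W'W imp].
  have /and5P[_ T0 + _ _] : separator arc Vinf [set y] T W' by case/andP: imp => /andP[].
  rewrite disjoints1 => yT; rewrite inE /sampled T0 yT; apply/hasP; exists W'.
    apply: important_leaf => //; rewrite leq_double.
    exact: leq_trans (subset_leq_card W'W) leW.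
  exact: subset_trans WU.
move: nE; rewrite inE YZ andbT => /pred0Pn[x /andP[/= xW xZ]].
move: xZ; rewrite in_set => /and3P[T0 _ /hasP[S Sl SU]].
apply/bigcupP; exists x; first by rewrite xW.
by rewrite (big_rem S) //= in_setU inE subUset WU SU.
Qed.

Lemma card_bigcup_seq (I : Type) (A : finType) (r : seq I) (F : I -> {set A}) :
  #|\bigcup_(i <- r) F i| <= \sum_(i <- r) #|F i|.
Proof.
elim/big_rec2: _ => [|i b C _ leC]; first by rewrite cards0.
by apply: leq_trans (leq_card_setU _ _) _; rewrite leq_add2l.
Qed.

(** A union bound over at most [k * 4 ^ k] bad events. The empty [W] is treated apart: for [k = 0]
    the required probability is 1, and a factor of two cannot be lost. *)
Lemma card_success : #|G| <= 2 * #|E| /\ (W = set0 -> #|G| <= #|E|).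
Proof.
have := subset_leq_card good_toss; set bads := \bigcup_(x in W | _) _ => leG.
have {}leG := leq_trans leG (leq_card_setU _ _).
split; last first.
  move=> W0; suff b0 : bads = set0 by rewrite b0 cards0 addn0 in leG.
  by apply: big1 => x; rewrite W0 inE.
have le_bads : #|bads| * 2 ^ q <= k * 2 ^ k.*2 * #|G|.
  have -> : k * 2 ^ k.*2 * #|G| = k * (2 ^ k.*2 * #|G|) by rewrite mulnA.
  apply: (@leq_trans (\sum_(x in W) 2 ^ k.*2 * #|G|)); last first.
    by rewrite sum_nat_const leq_mul2r leW orbT.
  rewrite /bads big_mkcondr /=.
  apply: (@leq_trans ((\sum_(x in W)
      #|if T != set0 then \bigcup_(S <- lv x) bad S else set0|) * 2 ^ q)).
    rewrite leq_mul2r; apply/orP; right; rewrite -!big_enum /=.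
    exact: card_bigcup_seq.
  rewrite big_distrl /=; apply: leq_sum => x xW.
  have [T0|] := boolP (T != set0); last by rewrite cards0.
  apply: (@leq_trans ((\sum_(S <- lv x) #|bad S|) * 2 ^ q)).
    by rewrite leq_mul2r card_bigcup_seq orbT.
  rewrite big_distrl /=; apply: (@leq_trans (\sum_(S <- lv x) #|G|)).
    by rewrite big_seq [leqRHS]big_seq; apply: leq_sum => S Sl; apply: card_bad Sl.
  by rewrite big_const_seq count_predT iter_addn_0 mulnC leq_mul2r size_leaves orbT.
have leq2 : (k * 2 ^ k.*2).*2 <= 2 ^ q.
  have lek : k <= 2 ^ k by apply/ltnW/ltn_expl.
  apply: (@leq_trans (2 * (2 ^ k * 2 ^ k.*2))).
    by rewrite -mul2n leq_mul2l /= leq_mul2r lek orbT.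
  by rewrite -expnD -expnS leq_exp2l // /nb_coins; lia.
have q0 : 0 < 2 ^ q by rewrite expn_gt0.
rewrite -(leq_pmul2r q0).
move: leq2 le_bads leG; move: (2 ^ q) (k * 2 ^ k.*2) #|bads| #|E| #|G|.
by clear; nia.
Qed.

Lemma success_prob : ((2 ^ (9 * k ^ 2))%:R^-1 <= coin_prob E)%R.
Proof.
have [le2 le1] := card_success; rewrite (card_coin_set leB) in le1 le2.
have pow_gt0 m : (0 < (2 ^ m)%:R :> rat)%R by rewrite Num.Theory.ltr0n expn_gt0.
rewrite /coin_prob Num.Theory.ler_pdivlMr // GRing.mulrC Num.Theory.ler_pdivrMr //.
rewrite -GRing.natrM Num.Theory.ler_nat.
have leWB : #|W| * q <= B.
  by apply: leq_trans leB; rewrite leq_mul2r -cardE max_card orbT.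
have [W0|Wn0] := eqVneq W set0.
  have := le1 W0; rewrite W0 cards0 subn0 => leBE.
  by apply: leq_trans leBE _; rewrite leq_pmulr // expn_gt0.
have k0 : 0 < k by apply: leq_trans leW; rewrite card_gt0.
apply: (@leq_trans (2 * #|E| * 2 ^ (#|W| * q))).
  by apply: leq_trans (leq_mul le2 (leqnn _)); rewrite -expnD subnK.
rewrite mulnAC -expnS mulnC leq_mul2l; apply/orP; right.
(* For [k >= 1], [k * q + 1 = 4k^2 + 4k + 1 <= 9k^2]. *)
rewrite leq_exp2l //; apply: (@leq_trans (k * q).+1).
  by rewrite ltnS leq_mul2r leW orbT.
by move: k0; rewrite /nb_coins; clear; nia.
Qed.

End Probability.

(** * Time bounds in terms of the input size *)

Lemma tree_size_enc_seq s : size s < tree_size (enc_seq s).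
Proof. by elim: s => //= e s; lia. Qed.

Lemma card_lt_tree_size (V : finType) (arc : rel V) (Vinf T : {set V}) k :
  size (enum V) < tree_size (enc_input arc Vinf T k).
Proof.
have := tree_size_enc_seq [seq enc_bool b | b <- [seq v \in Vinf | v <- enum V]].
by rewrite 2!size_map -/(enc_bits _) -/(enc_set _) /=; lia.
Qed.

(** One cubic search tree node, times [2 * 4 ^ k] nodes, times one search per vertex gives the
    fourth power. The added 2 pays for the initial call. *)
Lemma main_cost_leq (V : finType) k s : size (enum V) < s ->
  main_cost V k + 2 <= 30 * 1000 * 4 ^ k * s ^ 4.
Proof.
move=> lts; have szV : (size (enum V)).*2 = nb_nodes V by rewrite -size_nodes_of.
have : (nb_nodes V).+1 <= 2 * s by move: szV lts; clear; lia.
rewrite /main_cost /search_cost; move: (nb_nodes V).+1 => l lel.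
have -> : 2 ^ (k.*2).+1 = 2 * 4 ^ k by rewrite expnS -mul2n expnM.
have : k < 4 ^ k by apply: ltn_expl.
have s0 : 0 < s by apply: leq_ltn_trans lts.
have l2 : l * l <= 4 * s ^ 2.
  by apply: leq_trans (leq_mul lel lel) _; rewrite mulnACA -mulnn.
have l4 : l * l * l * l <= 16 * s ^ 4.
  by rewrite -mulnA; apply: leq_trans (leq_mul l2 l2) _; rewrite mulnACA -expnD.
have s24 : s ^ 2 <= s ^ 4 by rewrite leq_pexp2l.
have s40 : 0 < s ^ 4 by rewrite expn_gt0 s0.
move: (4 ^ k) (s ^ 4) (s ^ 2) l4 s24 s40 l2 => a s4 s2 l4 s24 s40 l2 ka.
have e1 : l * l * l * l * a <= 16 * s4 * a by rewrite leq_mul2r l4 orbT.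
have e2 : l * l * k.+1 <= 4 * s4 * a.
  by apply: leq_mul => //; apply: leq_trans l2 _; rewrite leq_mul2l.
have e3 : 1 <= s4 * a by rewrite muln_gt0 s40 (leq_trans _ ka).
(* The three terms contribute [16 * 1000], [4 * 1000] and 2, which fit into [30 * 1000]. *)
have -> : 500 * (l * l * l) * (2 * a) * l = 1000 * (l * l * l * l * a).
  by rewrite -[1000]/(500 * 2); lia.
move: e1 e2 e3; rewrite -!mulnA [a * s4]mulnC; move: (s4 * a); clear; lia.
Qed.

Theorem theorem6 :
  exists (P : program) (c d C : nat),
  forall (V : finType) (arc : rel V) (Vinf T : {set V}) (k : nat),
  let input := enc_input arc Vinf T k in
  let time_bound := c * 4 ^ k * tree_size input ^ d in
  exists Z : time_bound.-tuple bool -> {set V},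
  [/\ forall w : time_bound.-tuple bool,
        exists2 t, t <= time_bound & runs P input w (enc_set (Z w)) t,
      forall w : time_bound.-tuple bool, Z w \subset ~: T
    & forall W Y : {set V},
        W \subset ~: (T :|: Vinf) ->
        thin arc Vinf T W ->
        #|W| <= k ->
        (forall v, v \in Y ->
           exists2 W' : {set V},
             W' \subset W & important_separator arc Vinf [set v] T W') ->
        ((2 ^ (C * k ^ 2))%:R^-1 <=
           coin_prob [set w | [disjoint W & Z w] && (Y \subset Z w)])%R].
Proof.
exists prog, (30 * 1000), 4, 9 => V arc Vinf T k input time_bound.
have lts := card_lt_tree_size arc Vinf T k; rewrite -/input in lts.
(* The tuple of coins has the length of the time bound, so it must be long enough for the [q] tosses
   of every vertex. *)
have leB : size (enum V) * nb_coins k <= time_bound.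
  rewrite /time_bound /nb_coins; have : k < 4 ^ k by apply: ltn_expl.
  have : tree_size input <= tree_size input ^ 4.
    by rewrite -[leqLHS]expn1 leq_pexp2l //; apply: leq_ltn_trans lts.
  move: (4 ^ k) (tree_size input ^ 4) => a b leb lta.
  have : (size (enum V)) * k.+1 <= b * a.
    by apply: leq_mul => //; apply: leq_trans (ltnW lts) leb.
  by rewrite -mulnA [a * b]mulnC; move: (b * a); clear; lia.
exists (fun w => sample arc Vinf T k w); split=> [w|w|W Y sW thinW leW impY].
- have := @main_runs V arc Vinf T k w; rewrite size_tuple => /(_ leB) run.
  have [t let_ ev] := runs_in_call (runs_in_var w (erefl : onth [:: input] 0 = _))
    (erefl : (0 < size prog) = true) run.
  exists t; last by exists (drop (size (enum V) * nb_coins k) w).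
  by apply: leq_trans let_ _; apply: leq_trans (main_cost_leq k lts); lia.
- by apply/subsetP => v; rewrite !inE => /and3P[].
- exact: success_prob leB sW thinW leW impY.
Qed.
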